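(* Let $\mathbb{F}$ be a field of characteristic $p>2$, let $\mathfrak{g}=\tilde{P}(2)$ over $\mathbb{F}$, let $a,b\in\mathbb{F}_p$, and let $K(\lambda)$ be the Kac module of $\mathfrak{g}$ with $\lambda=a\varepsilon_1+b\varepsilon_2$. Then $$\dim \mathrm{H}^1(\mathfrak{g},K(\lambda))=\begin{cases}2, & \text{if } a+b=-2 \text{ and } \Phi(b)=p-2,\\ 1, & \text{if } (a+b=-2 \text{ or } a+b=-4) \text{ and } \Phi(b)=p-1,\\ 0, & \text{otherwise,}\end{cases}$$ where equalities involving $a+b$ are in $\mathbb{F}_p$.
   Context: All vector spaces are finite-dimensional over a field $\mathbb{F}$ of characteristic $p>2$; $\mathbb{F}_p\subseteq\mathbb{F}$ is the prime field. For $c\in\mathbb{F}_p$, $\Phi(c)\in\{0,1,\dots,p-1\}\subseteq\mathbb{Z}$ is the integer with $\Phi(c)\equiv c \pmod p$. The Lie superalgebra. $\mathfrak{g}=\tilde{P}(2)$ is the subalgebra of $\mathfrak{gl}(2|2)$ (with supercommutator) of all $4\times4$ block matrices $\begin{pmatrix}A&B\\ C&-A^T\end{pmatrix}$ with $A,B,C$ of size $2\times 2$, $B=B^T$, $C=-C^T$; block diagonal matrices are even and block off-diagonal matrices are odd. With $e_{ij}$ the matrix units, put $\gamma=e_{41}-e_{32}$, $h_1=e_{33}-e_{11}$, $h_2=e_{44}-e_{22}$, $\alpha=e_{43}-e_{12}$, $\beta=e_{34}-e_{21}$. Then $\mathfrak{g}=\mathfrak{g}_{-1}\oplus\mathfrak{g}_0\oplus\mathfrak{g}_{+1}$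 with bases: $\gamma$ of $\mathfrak{g}_{-1}$; $h_1,h_2,\alpha,\beta$ of $\mathfrak{g}_0$; $e_{13},e_{24},e_{14}+e_{23}$ of $\mathfrak{g}_{+1}$. Let $\mathfrak{h}=\langle h_1,h_2\rangle$ and let $\varepsilon_1,\varepsilon_2\in\mathfrak{h}^*$ satisfy $\varepsilon_i(h_j)=\delta_{ij}$. The Kac module. For $\lambda=a\varepsilon_1+b\varepsilon_2$ with $a,b\in\mathbb{F}_p$, $M(\lambda)$ is the simple $\mathfrak{g}_0$-module with basis $v_0,v_1,\dots,v_{\Phi(b-a)}$ and action $h_1v_k=(a+k)v_k$, $h_2v_k=(b-k)v_k$, $\alpha v_k=k(b-a-k+1)v_{k-1}$, $\beta v_k=v_{k+1}$ (with $v_{-1}=0$ and $v_{\Phi(b-a)+1}=0$). Let $\mathfrak{g}_{+1}$ act on $M(\lambda)$ by zero and set $K(\lambda)=U(\mathfrak{g})\otimes_{U(\mathfrak{g}_0\oplus\mathfrak{g}_{+1})}M(\lambda)$. It has basis $1\otimes v_k$ (even), $\gamma\otimes v_k$ (odd), $0\le k\le\Phi(b-a)$. Explicitly, with the same conventions on $v_{-1}$ and $v_{\Phi(b-a)+1}$: $h_1,h_2$ act on $1\otimes v_k$ by $a+k$, $b-k$ and on $\gamma\otimes v_k$ by $a+k+1$, $b-k+1$; $\alpha(u\otimes v_k)=k(b-a-k+1)\,u\otimes v_{k-1}$ and $\beta(u\otimes v_k)=u\otimes v_{k+1}$ for $u\in\{1,\gamma\}$; $\gamma(1\otimes v_k)=\gamma\otimes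 v_k$, $\gamma(\gamma\otimes v_k)=0$; $e_{13},e_{24},e_{14}+e_{23}$ kill $1\otimes v_k$; $e_{13}(\gamma\otimes v_k)=k(b-a-k+1)\,1\otimes v_{k-1}$, $(e_{14}+e_{23})(\gamma\otimes v_k)=(b-a-2k)\,1\otimes v_k$, $e_{24}(\gamma\otimes v_k)=-1\otimes v_{k+1}$. Cohomology. For a $\mathfrak{g}$-module $M$, a $\mathbb{Z}_2$-homogeneous linear map $\varphi:\mathfrak{g}\to M$ of parity $|\varphi|$ is a derivation if $\varphi([x,y])=(-1)^{|\varphi||x|}x\varphi(y)-(-1)^{|y|(|\varphi|+|x|)}y\varphi(x)$ for all homogeneous $x,y\in\mathfrak{g}$. It is inner if there is a homogeneous $v\in M$ with $\varphi(x)=(-1)^{|x||v|}xv$ for all homogeneous $x\in\mathfrak{g}$. $\mathrm{Der}(\mathfrak{g},M)$ and $\mathrm{Ider}(\mathfrak{g},M)$ are the spans of all homogeneous derivations and of all inner derivations, and $\mathrm{H}^1(\mathfrak{g},M)=\mathrm{Der}(\mathfrak{g},M)/\mathrm{Ider}(\mathfrak{g},M)$. *)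

(* Defs.v *)
From HB Require Import structures.
From mathcomp Require Import all_boot all_order all_algebra.
From mathcomp Require Import boolp.
From mathcomp Require Import ring.

Set Implicit Arguments.
Unset Strict Implicit.
Unset Printing Implicit Defensive.

Import GRing.Theory.
Local Open Scope ring_scope.

Section LinearAlgebra.
Variables (F : fieldType) (V : vectType F).

Definition is_lspan (S : V -> Prop) (U : {vspace V}) : Prop :=
  forall v, v \in U <->
    exists s : seq V, (forall x, x \in s -> S x) /\ v \in <<s>>%VS.

Lemma lspan_exists (S : V -> Prop) : exists U, is_lspan S U.
Proof.
pose P k := `[< exists s : seq V,
  (forall x, x \in s -> S x) /\ \dim <<s>>%VS = k >].
have exP : exists k, P k.
  by exists 0%N; apply/asboolP; exists [::]; rewrite span_nil dimv0.
have ubP k : P k -> (k <= \dim {:V})%N.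
  by move=> /asboolP[s [_ <-]]; rewrite dimvS ?subvf.
case: (ex_maxnP exP ubP) => m /asboolP[s [sS dims]] maxm.
exists <<s>>%VS => v; split=> [vs|[t [tS vt]]]; first by exists s.
have stS x : x \in s ++ t -> S x.
  by rewrite mem_cat => /orP[/sS|/tS].
have le_s_st : (<<s>> <= <<s ++ t>>)%VS by rewrite span_cat addvSl.
have /eqP-> : <<s>>%VS == <<s ++ t>>%VS.
  by rewrite eqEdim le_s_st dims maxm //; apply/asboolP; exists (s ++ t).
by rewrite span_cat; apply: subvP vt; rewrite addvSr.
Qed.

Definition lspan (S : V -> Prop) : {vspace V} := sval (cid (lspan_exists S)).

Lemma lspanP S : is_lspan S (lspan S).
Proof. exact: (svalP (cid (lspan_exists S))). Qed.

Lemma mem_lspan (S : V -> Prop) v : S v -> v \in lspan S.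
Proof.
move=> Sv; apply/lspanP; exists [:: v]; split; last first.
  by rewrite span_seq1 memv_line.
by move=> x; rewrite inE => /eqP->.
Qed.

Lemma lspan_subv (S : V -> Prop) (U : {vspace V}) :
  (forall v, S v -> v \in U) -> (lspan S <= U)%VS.
Proof.
move=> SU; apply/subvP => v /lspanP[s [sS]]; apply/subvP.
by apply/span_subvP => x /sS/SU.
Qed.

(* A linear map with kernel exactly W, hence U / W is represented by its      *)
(* image modv W @: U when W is a subspace of U.                               *)
Definition modv (W : {vspace V}) : 'End(V) := \1%VF - projv W.

Lemma lker_modv W : lker (modv W) = W.
Proof.
apply/vspaceP => v; rewrite memv_ker /modv add_lfunE opp_lfunE id_lfunE subr_eq0.
by apply/eqP/idP => [->|/projv_id->//]; rewrite memv_proj.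
Qed.

Definition quotv (U W : {vspace V}) : {vspace V} := (modv W @: U)%VS.

Lemma dim_quotv U W : (W <= U)%VS -> (\dim (quotv U W) + \dim W = \dim U)%N.
Proof.
move=> sWU; rewrite -(limg_ker_dim (modv W) U) lker_modv.
by rewrite (capv_idPr sWU) addnC.
Qed.

End LinearAlgebra.

(* The parities false and true are the even and the odd one.                  *)
Definition super_module (F : fieldType) (L V : lmodType F)
    (Lpar : bool -> pred L) (br : L -> L -> L) (act : L -> V -> V) : Prop :=
  [/\ forall x c u v, act x (c *: u + v) = c *: act x u + act x v,
      forall v c x y, act (c *: x + y) v = c *: act x v + act y v &
      forall i j x y v, Lpar i x -> Lpar j y ->
        act (br x y) v =
          act x (act y v) - (-1) ^+ (i && j) *: act y (act x v)].

Section Cohomology.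
Variables (F : fieldType) (L V : vectType F).
Variables (Lpar : bool -> pred L) (Vpar : bool -> pred V).
Variables (br : L -> L -> L) (act : L -> V -> V).

Definition homogeneous_map (d : bool) (f : 'Hom(L, V)) : Prop :=
  forall i x, Lpar i x -> Vpar (d (+) i) (f x).

Definition derivation (d : bool) (f : 'Hom(L, V)) : Prop :=
  homogeneous_map d f /\
  forall i j x y, Lpar i x -> Lpar j y ->
    f (br x y) = (-1) ^+ (d && i) *: act x (f y)
               - (-1) ^+ (j && (d (+) i)) *: act y (f x).

Definition inner (f : 'Hom(L, V)) : Prop :=
  exists d v, Vpar d v /\
    forall i x, Lpar i x -> f x = (-1) ^+ (i && d) *: act x v.

Definition Der : {vspace 'Hom(L, V)} :=
  lspan (fun f => exists d, derivation d f).

Definition Ider : {vspace 'Hom(L, V)} :=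
  lspan (fun f => (exists d, derivation d f) /\ inner f).

Definition H1 : {vspace 'Hom(L, V)} := quotv Der Ider.

Lemma Ider_sub_Der : (Ider <= Der)%VS.
Proof. by apply: lspan_subv => f [df _]; apply: mem_lspan. Qed.

Lemma dim_H1 : (\dim H1 + \dim Ider = \dim Der)%N.
Proof. exact: dim_quotv Ider_sub_Der. Qed.

End Cohomology.

Section P2.
Variable F : fieldType.
Local Notation M4 := 'M[F]_(2 + 2).

Definition gl_part (d : bool) (X : M4) : M4 :=
  if d then block_mx 0 (ursubmx X) (dlsubmx X) 0
  else block_mx (ulsubmx X) 0 0 (drsubmx X).

(* The supercommutator of gl(2|2), extended bilinearly from homogeneous       *)
(* matrices.                                                                  *)
Definition scomm (X Y : M4) : M4 :=
  \sum_(i : bool) \sum_(j : bool)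
    (gl_part i X *m gl_part j Y
     - (-1) ^+ (i && j) *: (gl_part j Y *m gl_part i X)).

Definition P2_defect (X : M4) : 'M[F]_2 * ('M[F]_2 * 'M[F]_2) :=
  (drsubmx X + (ulsubmx X)^T,
    (ursubmx X - (ursubmx X)^T, dlsubmx X + (dlsubmx X)^T)).

Fact P2_defect_is_linear : linear P2_defect.
Proof.
move=> c X Y; rewrite /P2_defect; congr (_, (_, _)); apply/matrixP => i j;
  by rewrite !mxE; ring.
Qed.
HB.instance Definition _ :=
  GRing.isLinear.Build F M4 ('M[F]_2 * ('M[F]_2 * 'M[F]_2))%type *:%R P2_defect
    P2_defect_is_linear.

Definition P2_space : {vspace M4} := lker (linfun P2_defect).

Lemma mem_P2 (X : M4) : reflect
  [/\ drsubmx X = - (ulsubmx X)^T, ursubmx X = (ursubmx X)^T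
    & dlsubmx X = - (dlsubmx X)^T]
  (X \in P2_space).
Proof.
rewrite memv_ker lfunE /= /P2_defect; apply: (iffP eqP).
  by case=> /eqP; rewrite addr_eq0 => /eqP-> /eqP;
     rewrite subr_eq0 => /eqP {1}-> /eqP; rewrite addr_eq0 => /eqP {1}->.
by move=> [-> {1}-> {1}->]; rewrite addNr subrr addNr.
Qed.

Definition P2 : vectType F := subvs_of P2_space.

Definition P2_par (d : bool) : pred P2 :=
  fun x => gl_part d (vsval x) == vsval x.

Definition P2_br (x y : P2) : P2 := vsproj P2_space (scomm (vsval x) (vsval y)).


Lemma gl_part_sum (X : M4) : gl_part false X + gl_part true X = X.
Proof.
by rewrite /gl_part add_block_mx !addr0 !add0r submxK.
Qed.

Lemma gl_part_id (d e : bool) (X : M4) :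
  gl_part d (gl_part e X) = if d == e then gl_part e X else 0.
Proof.
by case: d; case: e; rewrite /gl_part /= !(block_mxKul, block_mxKur, block_mxKdl,
  block_mxKdr) // block_mx0.
Qed.

Lemma gl_part_P2 d (X : M4) : X \in P2_space -> gl_part d X \in P2_space.
Proof.
move=> /mem_P2[hD hB hC]; apply/mem_P2; case: d; rewrite /gl_part /=
  !(block_mxKul, block_mxKur, block_mxKdl, block_mxKdr) ?trmx0 ?oppr0; split=> //.
Qed.

Lemma scomm_homog i j (X Y : M4) : gl_part i X = X -> gl_part j Y = Y ->
  scomm X Y = X *m Y - (-1) ^+ (i && j) *: (Y *m X).
Proof.
move=> <- <-; rewrite /scomm !big_bool !gl_part_id.
by case: i; case: j => /=; rewrite ?(mulmx0, mul0mx, scaler0, oppr0, addr0, add0r).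
Qed.

Lemma scomm_P2 (X Y : M4) :
  X \in P2_space -> Y \in P2_space -> scomm X Y \in P2_space.
Proof.
move=> hX hY; have trB (P Q : 'M[F]_2) : (P - Q)^T = P^T - Q^T by rewrite linearB.
have trN (P : 'M[F]_2) : (- P)^T = - P^T by rewrite linearN.
rewrite /scomm rpred_sum // => i _; rewrite rpred_sum // => j _.
move: (gl_part_P2 i hX) (gl_part_P2 j hY) => /mem_P2 + /mem_P2.
rewrite /gl_part.
case: i; case: j => /=;
  rewrite !(block_mxKul, block_mxKur, block_mxKdl, block_mxKdr) ?trmx0 ?oppr0;
  move=> [hD1 hB1 hC1] [hD2 hB2 hC2]; apply/mem_P2;
  rewrite !mulmx_block !scale_block_mx !opp_block_mx !add_block_mx;
  rewrite !(block_mxKul, block_mxKur, block_mxKdl, block_mxKdr).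
- rewrite !(mulmx0, mul0mx, scaler0, add0r, addr0, oppr0, trmx0) !expr1 !scaleN1r.
  rewrite !opprK !linearD /= !trmx_mul -hB1 -hB2; split=> //.
  have e1 : (dlsubmx X)^T = - dlsubmx X by rewrite {2}hC1 opprK.
  have e2 : (dlsubmx Y)^T = - dlsubmx Y by rewrite {2}hC2 opprK.
  by rewrite e1 e2 !mulNmx !opprK addrC.
- rewrite !(mulmx0, mul0mx, scaler0, add0r, addr0, oppr0, trmx0) !expr0 !scale1r.
  have e1 : (dlsubmx X)^T = - dlsubmx X by rewrite {2}hC1 opprK.
  have d2 : (drsubmx Y)^T = - ulsubmx Y by rewrite hD2 trN trmxK.
  rewrite !trB !trmx_mul -hB1 e1 d2 hD2; split=> //; rewrite ?mulmxN ?mulNmx ?opprK; try by rewrite ?opprB ?opprD ?opprK // addrC.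
- rewrite !(mulmx0, mul0mx, scaler0, add0r, addr0, oppr0, trmx0) !expr0 !scale1r.
  have e2 : (dlsubmx Y)^T = - dlsubmx Y by rewrite {2}hC2 opprK.
  have d1 : (drsubmx X)^T = - ulsubmx X by rewrite hD1 trN trmxK.
  rewrite !trB !trmx_mul -hB2 e2 d1 hD1; split=> //; rewrite ?mulmxN ?mulNmx ?opprK; try by rewrite ?opprB ?opprD ?opprK // addrC.
- rewrite !(mulmx0, mul0mx, scaler0, add0r, addr0, oppr0, trmx0) !expr0 !scale1r.
  rewrite hD1 hD2 !trB !trmx_mul !(mulNmx, mulmxN) !opprK.
  by split=> //; rewrite opprB.
Qed.

Lemma vsval_P2_br (x y : P2) : vsval (P2_br x y) = scomm (vsval x) (vsval y).
Proof. by rewrite vsprojK // scomm_P2 ?subvsP. Qed.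

(* Matrix units e_(i,j) of gl(2|2), with indices counted from 1.              *)
Definition e_ (i j : nat) : M4 := delta_mx (inord i.-1) (inord j.-1).

Definition gamma_mx : M4 := e_ 4 1 - e_ 3 2.
Definition h1_mx : M4 := e_ 3 3 - e_ 1 1.
Definition h2_mx : M4 := e_ 4 4 - e_ 2 2.
Definition alpha_mx : M4 := e_ 4 3 - e_ 1 2.
Definition beta_mx : M4 := e_ 3 4 - e_ 2 1.
Definition e13_mx : M4 := e_ 1 3.
Definition e24_mx : M4 := e_ 2 4.
Definition e14_23_mx : M4 := e_ 1 4 + e_ 2 3.

(* Coordinates of an element of P~(2) in this basis; see P2_coordE.           *)
Definition c_gamma (x : P2) : F := dlsubmx (vsval x) 1 0.
Definition c_h1 (x : P2) : F := drsubmx (vsval x) 0 0.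
Definition c_h2 (x : P2) : F := drsubmx (vsval x) 1 1.
Definition c_alpha (x : P2) : F := drsubmx (vsval x) 1 0.
Definition c_beta (x : P2) : F := drsubmx (vsval x) 0 1.
Definition c_e13 (x : P2) : F := ursubmx (vsval x) 0 0.
Definition c_e24 (x : P2) : F := ursubmx (vsval x) 1 1.
Definition c_e14_23 (x : P2) : F := ursubmx (vsval x) 0 1.

Lemma ord2P (P : 'I_2 -> Prop) : P 0 -> P 1 -> forall i, P i.
Proof.
move=> P0 P1 i; case: i => [[|[|//]] h].
  by rewrite (_ : Ordinal h = 0) //; apply: val_inj.
by rewrite (_ : Ordinal h = 1) //; apply: val_inj.
Qed.

Lemma dlsubmx_diag0 (x : P2) : 2%:R != 0 :> F ->
  forall i, dlsubmx (vsval x) i i = 0.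
Proof.
move=> two i; have /mem_P2[_ _ /matrixP/(_ i i)] := subvsP x.
rewrite !mxE => h; apply/eqP; move/eqP: h; rewrite -subr_eq0 opprK -mulr2n.
by rewrite -mulr_natl mulf_eq0 (negPf two).
Qed.

Lemma P2_coordE (x : P2) : 2%:R != 0 :> F ->
  vsval x = c_gamma x *: gamma_mx
    + (c_h1 x *: h1_mx + c_h2 x *: h2_mx
       + c_alpha x *: alpha_mx + c_beta x *: beta_mx)
    + (c_e13 x *: e13_mx + c_e24 x *: e24_mx + c_e14_23 x *: e14_23_mx).
Proof.
move=> two; have /mem_P2[hD hB hC] := subvsP x.
have hC0 := dlsubmx_diag0 x two.
have C01 : dlsubmx (vsval x) 0 1 = - dlsubmx (vsval x) 1 0.
  by rewrite {1}hC !mxE.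
have B10 : ursubmx (vsval x) 1 0 = ursubmx (vsval x) 0 1 by rewrite {1}hB mxE.
have hA i j : ulsubmx (vsval x) i j = - drsubmx (vsval x) j i.
  by rewrite hD !mxE opprK.
rewrite -[LHS]submxK; apply/matrixP => i j.
rewrite /c_gamma /c_h1 /c_h2 /c_alpha /c_beta /c_e13 /c_e24 /c_e14_23.
rewrite /gamma_mx /h1_mx /h2_mx /alpha_mx /beta_mx /e13_mx /e24_mx /e14_23_mx.
move: (drsubmx _) (dlsubmx _) (ursubmx _) (ulsubmx _) hC0 C01 B10 hA
  => D C B A hC0 C01 B10 hA.
rewrite -[i]splitK -[j]splitK.
case: (split i) => {}i; case: (split j) => {}j /=;
  rewrite ?(block_mxEul, block_mxEur, block_mxEdl, block_mxEdr);
  elim/ord2P: i; elim/ord2P: j; rewrite ?hC0 ?C01 ?B10 ?hA !mxE;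
  rewrite -!val_eqE /= !inordK //= ?mulr0n ?mulr1n;
  by rewrite ?(subr0, sub0r, subrr, oppr0, mulr0, mulr1, mulrN1, addr0, add0r).
Qed.

Lemma gamma_mx_block : gamma_mx =
  block_mx 0 0 (\matrix_(i, j) (i%:R - j%:R)) 0.
Proof.
apply/matrixP => i j; rewrite /gamma_mx -[i]splitK -[j]splitK.
case: (split i) => {}i; case: (split j) => {}j /=;
  rewrite ?(block_mxEul, block_mxEur, block_mxEdl, block_mxEdr);
  elim/ord2P: i; elim/ord2P: j; rewrite !mxE;
  rewrite -!val_eqE /= !inordK //= ?mulr0n ?mulr1n;
  by rewrite ?(subr0, sub0r, subrr, oppr0, mulr0, mulr1, mulrN1, addr0, add0r).
Qed.

Lemma P2_par0 (x : P2) : P2_par false x ->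
  ursubmx (vsval x) = 0 /\ dlsubmx (vsval x) = 0.
Proof. by move=> /eqP <-; rewrite block_mxKur block_mxKdl. Qed.

Lemma P2_par1 (x : P2) : P2_par true x -> drsubmx (vsval x) = 0.
Proof. by move=> /eqP <-; rewrite block_mxKdr. Qed.

Lemma P2_ul (x : P2) : ulsubmx (vsval x) = - (drsubmx (vsval x))^T.
Proof.
by have /mem_P2[-> _ _] := subvsP x; apply/matrixP => i j; rewrite !mxE opprK.
Qed.

Lemma P2_brC i j (x y : P2) : P2_par i x -> P2_par j y ->
  P2_br y x = - ((-1) ^+ (i && j)) *: P2_br x y.
Proof.
move=> /eqP px /eqP py; apply/val_inj.
change (vsval (P2_br y x) = - (-1) ^+ (i && j) *: vsval (P2_br x y)).
rewrite !vsval_P2_br.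
rewrite (scomm_homog py px) (scomm_homog px py) andbC.
move: (_ *m _) (_ *m _) => XY YX; apply/matrixP => k l; rewrite !mxE.
by case: (_ && _); rewrite ?expr1 ?expr0; ring.
Qed.

Lemma mul_submx (X Y : M4) :
  [/\ ulsubmx (X *m Y) = ulsubmx X *m ulsubmx Y + ursubmx X *m dlsubmx Y,
      ursubmx (X *m Y) = ulsubmx X *m ursubmx Y + ursubmx X *m drsubmx Y,
      dlsubmx (X *m Y) = dlsubmx X *m ulsubmx Y + drsubmx X *m dlsubmx Y &
      drsubmx (X *m Y) = dlsubmx X *m ursubmx Y + drsubmx X *m drsubmx Y].
Proof.
rewrite -[in X *m Y](submxK X) -[in _ *m Y](submxK Y) mulmx_block.
by rewrite block_mxKul block_mxKur block_mxKdl block_mxKdr.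
Qed.

Lemma sub_submx (X Y : M4) c :
  [/\ ursubmx (X - c *: Y) = ursubmx X - c *: ursubmx Y,
      dlsubmx (X - c *: Y) = dlsubmx X - c *: dlsubmx Y &
      drsubmx (X - c *: Y) = drsubmx X - c *: drsubmx Y].
Proof. by split; apply/matrixP => i j; rewrite !mxE. Qed.

Lemma P2_br_submx i j (x y : P2) (X := vsval x) (Y := vsval y)
    (Z := vsval (P2_br x y)) : P2_par i x -> P2_par j y ->
  let e : F := (-1) ^+ (i && j) in
  [/\ ursubmx Z = - ((drsubmx X)^T *m ursubmx Y) + ursubmx X *m drsubmx Y
        - e *: (- ((drsubmx Y)^T *m ursubmx X) + ursubmx Y *m drsubmx X),
      dlsubmx Z = - (dlsubmx X *m (drsubmx Y)^T) + drsubmx X *m dlsubmx Y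
        - e *: (- (dlsubmx Y *m (drsubmx X)^T) + drsubmx Y *m dlsubmx X) &
      drsubmx Z = dlsubmx X *m ursubmx Y + drsubmx X *m drsubmx Y
        - e *: (dlsubmx Y *m ursubmx X + drsubmx Y *m drsubmx X)].
Proof.
move=> /eqP px /eqP py e; rewrite /Z vsval_P2_br (scomm_homog px py) -/X -/Y -/e.
have [-> -> ->] := sub_submx (X *m Y) (Y *m X) e.
have [_ -> -> ->] := mul_submx X Y; have [_ -> -> ->] := mul_submx Y X.
by rewrite /X /Y !P2_ul !mulNmx !mulmxN.
Qed.

End P2.

(* For p prime, 'F_p consists of the ordinals c < p, and c%:R in a field of   *)
(* characteristic p is the image of c in the prime subfield.                  *)
Definition Phi (p : nat) (c : 'F_p) : nat := c.

Section Kac.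
Variables (F : fieldType) (p : nat) (a b : 'F_p).
Local Notation g := (P2 F).
Local Notation aF := ((Phi a)%:R : F).
Local Notation bF := ((Phi b)%:R : F).

Definition kdim : nat := (Phi (b - a)).+1.

Definition M_lambda : vectType F := 'rV[F]_kdim.

(* The basis vector v_k; it is 0 when k > Phi (b - a).                        *)
Definition v_ (k : nat) : 'rV[F]_kdim := \row_(j < kdim) (j == k :> nat)%:R.

(* Operators are matrices acting on row vectors from the right: row k is the  *)
(* image of v_ k. In M_alpha, row 0 vanishes because of the factor k.         *)
Definition M_h1 : 'M[F]_kdim := \matrix_(k < kdim) ((aF + k%:R) *: v_ k).
Definition M_h2 : 'M[F]_kdim := \matrix_(k < kdim) ((bF - k%:R) *: v_ k).
Definition M_alpha : 'M[F]_kdim :=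
  \matrix_(k < kdim) ((k%:R * (bF - aF - k%:R + 1)) *: v_ k.-1).
Definition M_beta : 'M[F]_kdim := \matrix_(k < kdim) v_ k.+1.

(* Action on M(lambda) of the elements of g_0 + g_1, that is, of the x with   *)
(* c_gamma x = 0; g_1 acts by zero.                                           *)
Definition M_act (x : g) (m : M_lambda) : M_lambda :=
  c_h1 x *: (m *m M_h1) + c_h2 x *: (m *m M_h2)
  + c_alpha x *: (m *m M_alpha) + c_beta x *: (m *m M_beta).

(* The pair (m, n) stands for 1 (x) m + gamma (x) n.                          *)
Definition Kac : vectType F := (M_lambda * M_lambda)%type.

Definition kac_par (d : bool) : pred Kac :=
  fun u => if d then u.1 == 0 else u.2 == 0.

Definition kac_h1 (u : Kac) : Kac :=
  (u.1 *m (\matrix_(k < kdim) ((aF + k%:R) *: v_ k)),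
   u.2 *m (\matrix_(k < kdim) ((aF + k%:R + 1) *: v_ k))).
Definition kac_h2 (u : Kac) : Kac :=
  (u.1 *m (\matrix_(k < kdim) ((bF - k%:R) *: v_ k)),
   u.2 *m (\matrix_(k < kdim) ((bF - k%:R + 1) *: v_ k))).
Definition kac_alpha (u : Kac) : Kac := (u.1 *m M_alpha, u.2 *m M_alpha).
Definition kac_beta (u : Kac) : Kac := (u.1 *m M_beta, u.2 *m M_beta).
Definition kac_gamma (u : Kac) : Kac := (0, u.1).
Definition kac_e13 (u : Kac) : Kac :=
  (u.2 *m (\matrix_(k < kdim) ((k%:R * (bF - aF - k%:R + 1)) *: v_ k.-1)), 0).
Definition kac_e24 (u : Kac) : Kac :=
  (u.2 *m (\matrix_(k < kdim) (- v_ k.+1)), 0).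
Definition kac_e14_23 (u : Kac) : Kac :=
  (u.2 *m (\matrix_(k < kdim) ((bF - aF - k.*2%:R) *: v_ k)), 0).

Definition kac_act (x : g) (u : Kac) : Kac :=
  c_gamma x *: kac_gamma u
  + (c_h1 x *: kac_h1 u + c_h2 x *: kac_h2 u
     + c_alpha x *: kac_alpha u + c_beta x *: kac_beta u)
  + (c_e13 x *: kac_e13 u + c_e24 x *: kac_e24 u
     + c_e14_23 x *: kac_e14_23 u).

Definition kac_H1 : {vspace 'Hom(g, Kac)} :=
  H1 (@P2_par F) kac_par (@P2_br F) kac_act.

(* kac_super_module, kac_act_par and kac_induced below show that kac_act is a *)
(* graded module structure, and the one induced from M_act.                   *)

Lemma v_matrix (R : nat -> 'rV[F]_kdim) k : (k < kdim)%N ->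
  v_ k *m (\matrix_(i < kdim) R i) = R k.
Proof.
move=> lt_k; have -> : v_ k = delta_mx 0 (Ordinal lt_k).
  by apply/rowP => j; rewrite !mxE -val_eqE.
by rewrite -rowE rowK.
Qed.

Lemma v_ge k : (kdim <= k)%N -> v_ k = 0.
Proof.
by move=> le_k; apply/rowP => j; rewrite !mxE ltn_eqF // (leq_trans _ le_k).
Qed.

Lemma eq_op (X Y : 'M[F]_kdim) : (forall k, v_ k *m X = v_ k *m Y) -> X = Y.
Proof.
move=> eqXY; apply/row_matrixP => i; rewrite !rowE.
suff -> : delta_mx 0 i = v_ i by [].
by apply/rowP => j; rewrite !mxE -val_eqE.
Qed.

Lemma v_h1 k : v_ k *m M_h1 = (aF + k%:R) *: v_ k.
Proof.
case: (ltnP k kdim) => [lt_k|le_k].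
  by rewrite /M_h1 (v_matrix (fun k : nat => (aF + k%:R) *: v_ k)).
by rewrite v_ge // mul0mx scaler0.
Qed.

Lemma v_h2 k : v_ k *m M_h2 = (bF - k%:R) *: v_ k.
Proof.
case: (ltnP k kdim) => [lt_k|le_k].
  by rewrite /M_h2 (v_matrix (fun k : nat => (bF - k%:R) *: v_ k)).
by rewrite v_ge // mul0mx scaler0.
Qed.

Lemma v_beta k : v_ k *m M_beta = v_ k.+1.
Proof.
case: (ltnP k kdim) => [lt_k|le_k].
  by rewrite /M_beta (v_matrix (fun k : nat => v_ k.+1)).
by rewrite v_ge // mul0mx v_ge // leqW.
Qed.

Hypothesis pcharFp : p \in [pchar F].

Lemma Phi_sub : (Phi (b - a))%:R = bF - aF.
Proof.
have pr : prime p by case/andP: pcharFp.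
have p0 : p%:R = 0 :> F by apply/eqP; case/andP: pcharFp.
have red (n : nat) : (n %% p)%:R = n%:R :> F.
  by rewrite [in RHS](divn_eq n p) natrD natrM p0 mulr0 add0r.
have PhiD (c d : 'F_p) : Phi (c + d) = ((Phi c + Phi d) %% p)%N.
  by rewrite -[X in _ = (_ %% X)%N](Fp_cast pr).
have -> : Phi b = ((Phi (b - a)%R + Phi a) %% p)%N by rewrite -PhiD subrK.
by rewrite red natrD addrK.
Qed.

Lemma v_alpha k : v_ k *m M_alpha = (k%:R * (bF - aF - k%:R + 1)) *: v_ k.-1.
Proof.
case: (ltngtP k kdim) => [lt_k|lt_k|->].
- by rewrite /M_alpha (v_matrix
    (fun k : nat => (k%:R * (bF - aF - k%:R + 1)) *: v_ k.-1)).
- rewrite !v_ge ?mul0mx ?scaler0 //; last exact: ltnW.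
  by case: k lt_k.
- have -> : bF - aF - kdim%:R + 1 = 0.
    by rewrite /kdim -addn1 natrD Phi_sub opprD addrA subrr add0r addNr.
  by rewrite v_ge // mul0mx mulr0 scale0r.
Qed.

Lemma M_h1h2 : M_h2 *m M_h1 = M_h1 *m M_h2.
Proof.
apply: eq_op => k; rewrite !mulmxA v_h1 v_h2 -!scalemxAl v_h1 v_h2 !scalerA.
by rewrite mulrC.
Qed.

Lemma M_h1alpha : M_h1 *m M_alpha = M_alpha *m M_h1 + M_alpha.
Proof.
apply: eq_op => -[|k]; rewrite mulmxDr !mulmxA v_h1 v_alpha -!scalemxAl v_h1 v_alpha.
  by rewrite !scalerA !mul0r mulr0 scale0r addr0.
by rewrite !scalerA -scalerDl /=; congr (_ *: _); rewrite -addn1 natrD; ring.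
Qed.

Lemma M_h2alpha : M_h2 *m M_alpha = M_alpha *m M_h2 - M_alpha.
Proof.
apply: eq_op => -[|k]; rewrite mulmxBr !mulmxA v_h2 v_alpha -!scalemxAl v_h2 v_alpha.
  by rewrite !scalerA !mul0r mulr0 scale0r subr0.
by rewrite !scalerA -scalerBl /=; congr (_ *: _); rewrite -addn1 natrD; ring.
Qed.

Lemma M_h1beta : M_h1 *m M_beta = M_beta *m M_h1 - M_beta.
Proof.
apply: eq_op => k; rewrite mulmxBr !mulmxA v_h1 v_beta -!scalemxAl v_h1 v_beta.
by rewrite -{3}[v_ _]scale1r -scalerBl; congr (_ *: _); rewrite -addn1 natrD; ring.
Qed.

Lemma M_h2beta : M_h2 *m M_beta = M_beta *m M_h2 + M_beta.
Proof.
apply: eq_op => k; rewrite mulmxDr !mulmxA v_h2 v_beta -!scalemxAl v_h2 v_beta.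
by rewrite -{3}[v_ _]scale1r -scalerDl; congr (_ *: _); rewrite -addn1 natrD; ring.
Qed.

Lemma M_betaalpha : M_beta *m M_alpha = M_alpha *m M_beta + (M_h2 - M_h1).
Proof.
apply: eq_op => -[|k]; rewrite mulmxDr mulmxBr !mulmxA v_h1 v_h2 v_beta !v_alpha;
  rewrite -!scalemxAl v_beta /= -scalerBl; last first.
  by rewrite -scalerDl; congr (_ *: _); rewrite -!natr1; ring.
by rewrite mul0r scale0r add0r; congr (_ *: _); ring.
Qed.

Definition opT (x : g) : 'M[F]_kdim :=
  c_h1 x *: M_h1 + c_h2 x *: M_h2 + c_alpha x *: M_alpha + c_beta x *: M_beta.
Definition opS (x : g) : 'M[F]_kdim :=
  c_e13 x *: M_alpha - c_e24 x *: M_beta + c_e14_23 x *: (M_h2 - M_h1).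
Definition ctr (x : g) : F := c_h1 x + c_h2 x.

Lemma M_actE x m : M_act x m = m *m opT x.
Proof. by rewrite /M_act /opT !mulmxDr -!scalemxAr. Qed.

Lemma kac_actE x u : kac_act x u =
  (u.1 *m opT x + u.2 *m opS x,
   u.2 *m opT x + ctr x *: u.2 + c_gamma x *: u.1).
Proof.
have eh1 : \matrix_(k < kdim) ((aF + k%:R + 1) *: v_ k) = M_h1 + 1%:M.
  apply: eq_op => k; rewrite mulmxDr mulmx1 v_h1 -{3}[v_ k]scale1r -scalerDl.
  case: (ltnP k kdim) => [lt_k|le_k].
    by rewrite (v_matrix (fun k : nat => (aF + k%:R + 1) *: v_ k)).
  by rewrite v_ge // mul0mx scaler0.
have eh2 : \matrix_(k < kdim) ((bF - k%:R + 1) *: v_ k) = M_h2 + 1%:M.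
  apply: eq_op => k; rewrite mulmxDr mulmx1 v_h2 -{3}[v_ k]scale1r -scalerDl.
  case: (ltnP k kdim) => [lt_k|le_k].
    by rewrite (v_matrix (fun k : nat => (bF - k%:R + 1) *: v_ k)).
  by rewrite v_ge // mul0mx scaler0.
have e24 : \matrix_(k < kdim) (- v_ k.+1) = - M_beta.
  by apply/matrixP => i j; rewrite !mxE.
have e1423 : \matrix_(k < kdim) ((bF - aF - k.*2%:R) *: v_ k) = M_h2 - M_h1.
  by apply/matrixP => i j; rewrite !mxE -addnn natrD; ring.
case: u => m n; rewrite /kac_act /kac_gamma /kac_h1 /kac_h2 /kac_alpha /kac_beta.
rewrite /kac_e13 /kac_e24 /kac_e14_23 /= eh1 eh2 e24 e1423 -/M_h1 -/M_h2 -/M_alpha.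
rewrite /opT /opS /ctr !(mulmxDr, mulmxN, mulmx1) -!scalemxAr !mulmxDr mulmxN.
congr (_, _) => /=; apply/rowP => j.
  move: (m *m M_h1) (m *m M_h2) (m *m M_alpha) (m *m M_beta).
  move: (n *m M_h1) (n *m M_h2) (n *m M_alpha) (n *m M_beta) => *.
  by rewrite !mxE; ring.
move: (m *m M_h1) (m *m M_h2) (m *m M_alpha) (m *m M_beta).
move: (n *m M_h1) (n *m M_h2) (n *m M_alpha) (n *m M_beta) => *.
by rewrite !mxE; ring.
Qed.

Hypothesis p_gt2 : (2 < p)%N.

Lemma two_neq0 : 2%:R != 0 :> F.
Proof.
by rewrite -(dvdn_pcharf pcharFp) gtnNdvd.
Qed.

Lemma mul2E (P Q : 'M[F]_2) :
  P *m Q = \matrix_(i, j) (P i 0 * Q 0 j + P i 1 * Q 1 j).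
Proof.
apply/matrixP => i j; rewrite !mxE big_ord_recl big_ord1.
have -> : lift ord0 ord0 = 1 :> 'I_2 by apply: val_inj.
by [].
Qed.

Lemma P2_sym (x : g) (B := ursubmx (vsval x)) (C := dlsubmx (vsval x)) :
  [/\ B 1 0 = B 0 1, C 0 1 = - C 1 0, C 0 0 = 0 & C 1 1 = 0].
Proof.
have /mem_P2[_ /matrixP/(_ 1 0) hB /matrixP/(_ 0 1) hC] := subvsP x.
have C0 := dlsubmx_diag0 x two_neq0.
by split; [rewrite [LHS]hB !mxE | rewrite [LHS]hC !mxE | exact: C0 | exact: C0].
Qed.

Ltac coord_ring x y :=
  move: (P2_sym x) (P2_sym y);
  rewrite /ctr /c_gamma /c_h1 /c_h2 /c_alpha /c_beta /c_e13 /c_e24 /c_e14_23;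
  move: (drsubmx (vsval x)) (ursubmx (vsval x)) (dlsubmx (vsval x));
  move: (drsubmx (vsval y)) (ursubmx (vsval y)) (dlsubmx (vsval y));
  let h1 := fresh in let h2 := fresh in let h3 := fresh in let h4 := fresh in
  let h5 := fresh in let h6 := fresh in let h7 := fresh in let h8 := fresh in
  move=> ? ? ? ? ? ? [h1 h2 h3 h4] [h5 h6 h7 h8];
  rewrite ?mxE ?h1 ?h2 ?h3 ?h4 ?h5 ?h6 ?h7 ?h8 /=; ring.

Ltac op_ring :=
  rewrite /opT /opS ?(scalerBr, mulmxDl, mulmxDr, mulmxBl, mulmxBr, mulNmx, mulmxN);
  rewrite -?scalemxAl -?scalemxAr -?scalemxAl;
  rewrite ?(mulmxDl, mulmxDr, mulmxBl, mulmxBr, mulNmx, mulmxN);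
  rewrite ?(M_h1alpha, M_h2alpha, M_h1beta, M_h2beta, M_betaalpha, M_h1h2);
  move: (M_alpha *m M_h1) (M_alpha *m M_h2) (M_beta *m M_h1) (M_beta *m M_h2)
    (M_alpha *m M_beta) (M_h1 *m M_h2) (M_h1 *m M_h1) (M_h2 *m M_h2)
    (M_alpha *m M_alpha) (M_beta *m M_beta);
  move: M_alpha M_beta M_h1 M_h2 => *;
  apply/matrixP => ? ?; rewrite !mxE; ring.

Lemma P2_br00 (x y : g) : P2_par false x -> P2_par false y ->
  [/\ opT (P2_br x y) = opT y *m opT x - opT x *m opT y,
      opS (P2_br x y) = 0, ctr (P2_br x y) = 0 & c_gamma (P2_br x y) = 0].
Proof.
move=> px py; have [e1 e2 e3] := P2_br_submx px py.
have [bx cx] := P2_par0 px; have [b_y cy] := P2_par0 py.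
have c1 : c_h1 (P2_br x y) = c_beta x * c_alpha y - c_beta y * c_alpha x.
  by rewrite /c_h1 e3 cx cy !mul0mx !mul2E; coord_ring x y.
have c2 : c_h2 (P2_br x y) = c_alpha x * c_beta y - c_alpha y * c_beta x.
  by rewrite /c_h2 e3 cx cy !mul0mx !mul2E; coord_ring x y.
have c3 : c_alpha (P2_br x y) =
    (c_h2 x - c_h1 x) * c_alpha y - (c_h2 y - c_h1 y) * c_alpha x.
  by rewrite /c_alpha e3 cx cy !mul0mx !mul2E; coord_ring x y.
have c4 : c_beta (P2_br x y) =
    (c_h1 x - c_h2 x) * c_beta y - (c_h1 y - c_h2 y) * c_beta x.
  by rewrite /c_beta e3 cx cy !mul0mx !mul2E; coord_ring x y.
have [c5 c6 c7 c8] : [/\ c_e13 (P2_br x y) = 0, c_e24 (P2_br x y) = 0,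
    c_e14_23 (P2_br x y) = 0 & c_gamma (P2_br x y) = 0].
  by rewrite /c_e13 /c_e24 /c_e14_23 /c_gamma e1 e2 bx b_y cx cy ?(mulmx0, mul0mx)
    !mxE; split; ring.
split=> //; last 2 first.
- by rewrite /opS c5 c6 c7 !scale0r subrr addr0.
- by rewrite /ctr c1 c2; ring.
by rewrite {1}/opT c1 c2 c3 c4; op_ring.
Qed.

Lemma P2_br01 (x y : g) : P2_par false x -> P2_par true y ->
  [/\ opT (P2_br x y) = 0, ctr (P2_br x y) = 0,
      opS (P2_br x y) = opS y *m opT x - opT x *m opS y - ctr x *: opS y &
      c_gamma (P2_br x y) = ctr x * c_gamma y].
Proof.
move=> px py; have [e1 e2 e3] := P2_br_submx px py.
have [bx cx] := P2_par0 px; have dy := P2_par1 py.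
have [c1 c2 c3 c4] : [/\ c_h1 (P2_br x y) = 0, c_h2 (P2_br x y) = 0,
    c_alpha (P2_br x y) = 0 & c_beta (P2_br x y) = 0].
  by rewrite /c_h1 /c_h2 /c_alpha /c_beta e3 bx dy cx ?(mulmx0, mul0mx) !mxE;
    split; ring.
have c5 : c_e13 (P2_br x y) =
    - 2%:R * c_h1 x * c_e13 y - 2%:R * c_alpha x * c_e14_23 y.
  by rewrite /c_e13 e1 bx dy ?trmx0 ?(mulmx0, mul0mx) !mul2E; coord_ring x y.
have c6 : c_e24 (P2_br x y) =
    - 2%:R * c_h2 x * c_e24 y - 2%:R * c_beta x * c_e14_23 y.
  by rewrite /c_e24 e1 bx dy ?trmx0 ?(mulmx0, mul0mx) !mul2E; coord_ring x y.
have c7 : c_e14_23 (P2_br x y) =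
    - ctr x * c_e14_23 y - c_beta x * c_e13 y - c_alpha x * c_e24 y.
  by rewrite /c_e14_23 e1 bx dy ?trmx0 ?(mulmx0, mul0mx) !mul2E; coord_ring x y.
have c8 : c_gamma (P2_br x y) = ctr x * c_gamma y.
  by rewrite /c_gamma e2 cx dy ?trmx0 ?(mulmx0, mul0mx) !mul2E; coord_ring x y.
split=> //.
- by rewrite /opT c1 c2 c3 c4 !scale0r !addr0.
- by rewrite /ctr c1 c2 addr0.
by rewrite {1}/opS c5 c6 c7 /ctr; op_ring.
Qed.

Lemma P2_br11 (x y : g) : P2_par true x -> P2_par true y ->
  [/\ opT (P2_br x y) = c_gamma y *: opS x + c_gamma x *: opS y,
      opS (P2_br x y) = 0, ctr (P2_br x y) = 0 & c_gamma (P2_br x y) = 0].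
Proof.
move=> px py; have [e1 e2 e3] := P2_br_submx px py.
have dx := P2_par1 px; have dy := P2_par1 py.
have [c5 c6 c7 c8] : [/\ c_e13 (P2_br x y) = 0, c_e24 (P2_br x y) = 0,
    c_e14_23 (P2_br x y) = 0 & c_gamma (P2_br x y) = 0].
  by rewrite /c_e13 /c_e24 /c_e14_23 /c_gamma e1 e2 dx dy ?trmx0 ?(mulmx0, mul0mx)
    !mxE; split; ring.
have c1 : c_h1 (P2_br x y) = - c_gamma x * c_e14_23 y - c_gamma y * c_e14_23 x.
  by rewrite /c_h1 e3 dx ?(mulmx0, mul0mx) !mul2E; coord_ring x y.
have c2 : c_h2 (P2_br x y) = c_gamma x * c_e14_23 y + c_gamma y * c_e14_23 x.
  by rewrite /c_h2 e3 dx ?(mulmx0, mul0mx) !mul2E; coord_ring x y.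
have c3 : c_alpha (P2_br x y) = c_gamma x * c_e13 y + c_gamma y * c_e13 x.
  by rewrite /c_alpha e3 dx ?(mulmx0, mul0mx) !mul2E; coord_ring x y.
have c4 : c_beta (P2_br x y) = - c_gamma x * c_e24 y - c_gamma y * c_e24 x.
  by rewrite /c_beta e3 dx ?(mulmx0, mul0mx) !mul2E; coord_ring x y.
split=> //; last 2 first.
- by rewrite /opS c5 c6 c7 !scale0r subrr addr0.
- by rewrite /ctr c1 c2; ring.
by rewrite {1}/opT c1 c2 c3 c4; op_ring.
Qed.

Lemma opT_odd (x : g) : P2_par true x -> opT x = 0 /\ ctr x = 0.
Proof.
move=> px; have dx := P2_par1 px.
rewrite /opT /ctr /c_h1 /c_h2 /c_alpha /c_beta dx.
have z i j : (0 : 'M[F]_2) i j = 0 by rewrite mxE.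
by rewrite !z !scale0r !addr0.
Qed.

Lemma opS_even (x : g) : P2_par false x -> opS x = 0 /\ c_gamma x = 0.
Proof.
move=> px; have [bx cx] := P2_par0 px.
rewrite /opS /c_e13 /c_e24 /c_e14_23 /c_gamma bx cx.
have z i j : (0 : 'M[F]_2) i j = 0 by rewrite mxE.
by rewrite !z !scale0r subr0 !addr0.
Qed.

Lemma coord_lin c (x y : g) :
  [/\ opT (c *: x + y) = c *: opT x + opT y,
      opS (c *: x + y) = c *: opS x + opS y,
      ctr (c *: x + y) = c * ctr x + ctr y &
      c_gamma (c *: x + y) = c * c_gamma x + c_gamma y].
Proof.
have cl (f : 'M[F]_(2 + 2) -> 'M[F]_2) i j :
    (forall X Y : 'M[F]_(2 + 2), f (c *: X + Y) = c *: f X + f Y) ->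
    f (vsval (c *: x + y)) i j = c * f (vsval x) i j + f (vsval y) i j.
  move=> fl; change (vsval (c *: x + y)) with (c *: vsval x + vsval y).
  by rewrite fl !mxE.
have ld X Y : drsubmx (c *: X + Y : 'M[F]_(2 + 2)) = c *: drsubmx X + drsubmx Y.
  by apply/matrixP => i j; rewrite !mxE.
have lu X Y : ursubmx (c *: X + Y : 'M[F]_(2 + 2)) = c *: ursubmx X + ursubmx Y.
  by apply/matrixP => i j; rewrite !mxE.
have ll X Y : dlsubmx (c *: X + Y : 'M[F]_(2 + 2)) = c *: dlsubmx X + dlsubmx Y.
  by apply/matrixP => i j; rewrite !mxE.
rewrite /opT /opS /ctr /c_h1 /c_h2 /c_alpha /c_beta /c_e13 /c_e24 /c_e14_23.
rewrite /c_gamma !(cl _ _ _ ld) !(cl _ _ _ lu) !(cl _ _ _ ll).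
by split; try ring; move: M_alpha M_beta M_h1 M_h2 => *; apply/matrixP => i j;
  rewrite !mxE; ring.
Qed.

Lemma kac_act_linl (u : Kac) c (x y : g) :
  kac_act (c *: x + y) u = c *: kac_act x u + kac_act y u.
Proof.
rewrite !kac_actE; have [-> -> -> ->] := coord_lin c x y.
case: u => m n /=; move: (opT x) (opT y) (opS x) (opS y) => *.
rewrite !mulmxDr -!scalemxAr.
by congr (_, _); apply/rowP => j; rewrite /= !mxE; ring.
Qed.

Lemma kac_act_linr (x : g) c (u v : Kac) :
  kac_act x (c *: u + v) = c *: kac_act x u + kac_act x v.
Proof.
rewrite !kac_actE; case: u => m n; case: v => m' n' /=.
rewrite !mulmxDl -!scalemxAl.
by congr (_, _); apply/rowP => j; rewrite /= !mxE; ring.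
Qed.

Theorem kac_super_module : super_module (@P2_par F) (@P2_br F) kac_act.
Proof.
split; [exact: kac_act_linr | exact: kac_act_linl | ].
have actN (x : g) u : kac_act (- x) u = - kac_act x u.
  have := kac_act_linl u (-1) x 0; rewrite scaleN1r addr0 => ->.
  have := kac_act_linl u (-1) x x.
  rewrite scaleN1r addNr => h0; rewrite scaleN1r.
  suff -> : kac_act 0 u = 0 by rewrite addr0.
  by rewrite h0 scaleN1r addNr.
have even_odd (x y : g) u : P2_par false x -> P2_par true y ->
    kac_act (P2_br x y) u = kac_act x (kac_act y u) - kac_act y (kac_act x u).
  move=> px py; rewrite !kac_actE.
  have [-> -> -> ->] := P2_br01 px py.
  have [-> ->] := opT_odd py; have [-> ->] := opS_even px.
  case: u => m n /=; move: (ctr x) (opT x) (opS x) (opS y) => *.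
  rewrite !(mulmxDl, mulmxDr, mulmxBr, mulmxN, mulNmx, mulmx0, mul0mx).
  rewrite -?scalemxAl -?scalemxAr ?mulmxA.
  by congr (_, _); apply/rowP => j; rewrite /= !mxE; ring.
case=> [] [] x y u px py; rewrite /= ?expr1 ?expr0 ?scaleN1r ?scale1r ?opprK.
- rewrite !kac_actE.
  have [-> -> -> ->] := P2_br11 px py.
  have [-> ->] := opT_odd py; have [-> ->] := opT_odd px.
  case: u => m n /=; move: (ctr x) (opT x) (opS x) (opS y) => *.
  rewrite !(mulmxDl, mulmxDr, mulmxBr, mulmxN, mulNmx, mulmx0, mul0mx).
  rewrite -?scalemxAl -?scalemxAr ?mulmxA.
  by congr (_, _); apply/rowP => j; rewrite /= !mxE; ring.
- rewrite (P2_brC py px) /= expr0 scaleN1r actN even_odd //.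
  by rewrite opprB.
- exact: even_odd.
- rewrite !kac_actE.
  have [-> -> -> ->] := P2_br00 px py.
  have [-> ->] := opS_even py; have [-> ->] := opS_even px.
  case: u => m n /=; move: (ctr x) (ctr y) (opT x) (opT y) => *.
  rewrite !(mulmxDl, mulmxDr, mulmxBr, mulmxBl, mulmxN, mulNmx, mulmx0, mul0mx).
  rewrite -?scalemxAl -?scalemxAr ?mulmxA.
  by congr (_, _); apply/rowP => j; rewrite /= !mxE; ring.
Qed.

Lemma kac_act_par i d (x : g) u : P2_par i x -> kac_par d u ->
  kac_par (d (+) i) (kac_act x u).
Proof.
move=> px; rewrite kac_actE; case: u => m n.
case: i px => px; case: d => /= /eqP->.
- by have [e1 e2] := opT_odd px; rewrite e1 e2 mulmx0 !scale0r scaler0 !addr0.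
- by have [e1 e2] := opT_odd px; rewrite e1 mulmx0 mul0mx addr0.
- by have [e1 e2] := opS_even px; rewrite e1 mul0mx mulmx0 addr0.
- by have [e1 e2] := opS_even px; rewrite e2 mul0mx scale0r scaler0 !addr0.
Qed.

Lemma kac_act_M (x : g) (m : M_lambda) : c_gamma x = 0 ->
  kac_act x (m, 0) = (M_act x m, 0).
Proof.
move=> c0; rewrite kac_actE M_actE c0 /= !mul0mx.
by rewrite scaler0 scale0r !addr0.
Qed.

Definition gamma : g := vsproj (P2_space F) (gamma_mx F).

Lemma vsval_gamma : vsval gamma = gamma_mx F.
Proof.
rewrite vsprojK // gamma_mx_block; apply/mem_P2.
rewrite block_mxKul block_mxKur block_mxKdl block_mxKdr !trmx0 oppr0; split=> //.
by apply/matrixP => i j; rewrite !mxE opprB.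
Qed.

Lemma P2_even_odd (x : g) : exists x0 x1 : g,
  [/\ P2_par false x0, P2_par true x1 & x = x0 + x1].
Proof.
have pP d := gl_part_P2 d (subvsP x).
exists (vsproj (P2_space F) (gl_part false (vsval x))).
exists (vsproj (P2_space F) (gl_part true (vsval x))).
split; [by rewrite /P2_par vsprojK // gl_part_id eqxx.. | apply/val_inj].
change (vsval x = vsval (vsproj (P2_space F) (gl_part false (vsval x)))
                + vsval (vsproj (P2_space F) (gl_part true (vsval x)))).
by rewrite !vsprojK // gl_part_sum.
Qed.

Lemma gammaP : [/\ P2_par true gamma, c_gamma gamma = 1 & opS gamma = 0].
Proof.
rewrite /opS /P2_par /c_gamma /c_e13 /c_e24 /c_e14_23 vsval_gamma gamma_mx_block.
rewrite /gl_part !(block_mxKur, block_mxKdl) !mxE /= subr0; split=> //.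
by rewrite !scale0r subrr addr0.
Qed.

Lemma P2_coords_eq0 (x : g) :
  [/\ c_h1 x = 0, c_h2 x = 0, c_alpha x = 0 & c_beta x = 0] ->
  [/\ c_e13 x = 0, c_e24 x = 0, c_e14_23 x = 0 & c_gamma x = 0] -> x = 0.
Proof.
move=> [h1 h2 h3 h4] [h5 h6 h7 h8]; apply/val_inj.
by rewrite /= (P2_coordE x two_neq0) h1 h2 h3 h4 h5 h6 h7 h8 !scale0r !addr0.
Qed.

Lemma br_gamma_even (x : g) : P2_par false x -> P2_br x gamma = ctr x *: gamma.
Proof.
move=> px; have [pg cg sg] := gammaP; have [e1 e2 e3] := P2_br_submx px pg.
have [bx cx] := P2_par0 px; have dg := P2_par1 pg.
have z i j : (0 : 'M[F]_2) i j = 0 by rewrite mxE.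
have ug : ursubmx (vsval gamma) = 0.
  by rewrite vsval_gamma gamma_mx_block block_mxKur.
have [_ _ _ c8] := P2_br01 px pg.
have d0 : drsubmx (vsval (P2_br x gamma)) = 0.
  by rewrite e3 cx bx dg !(mulmx0, mul0mx, addr0, scaler0, oppr0).
have u0 : ursubmx (vsval (P2_br x gamma)) = 0.
  by rewrite e1 bx dg ug trmx0 !(mulmx0, mul0mx, addr0, scaler0, oppr0).
apply/eqP; rewrite -subr_eq0; apply/eqP; apply: P2_coords_eq0.
  rewrite /c_h1 /c_h2 /c_alpha /c_beta.
  have -> : drsubmx (vsval (P2_br x gamma - ctr x *: gamma)) = 0.
    change (drsubmx (vsval (P2_br x gamma) - ctr x *: vsval gamma) = 0).
    have [_ _ ->] := sub_submx (vsval (P2_br x gamma)) (vsval gamma) (ctr x).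
    by rewrite d0 dg scaler0 subr0.
  by rewrite !z.
rewrite /c_e13 /c_e24 /c_e14_23.
have [e4 e5 _] := sub_submx (vsval (P2_br x gamma)) (vsval gamma) (ctr x).
have -> : ursubmx (vsval (P2_br x gamma - ctr x *: gamma)) = 0.
  change (ursubmx (vsval (P2_br x gamma) - ctr x *: vsval gamma) = 0).
  by rewrite e4 u0 ug scaler0 subr0.
rewrite !z; split=> //; rewrite /c_gamma.
change (dlsubmx (vsval (P2_br x gamma) - ctr x *: vsval gamma) 1 0 = 0).
have entry (P Q : 'M[F]_2) c : (P - c *: Q) 1 0 = P 1 0 - c * Q 1 0.
  by rewrite !mxE.
rewrite e5 entry -/(c_gamma (P2_br x gamma)) -/(c_gamma gamma) c8 cg.
by rewrite mulr1 subrr.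
Qed.

Theorem kac_induced (W : lmodType F) (actW : g -> W -> W)
    (f : M_lambda -> W) :
  super_module (@P2_par F) (@P2_br F) actW ->
  linear f ->
  (forall x m, c_gamma x = 0 -> f (M_act x m) = actW x (f m)) ->
  exists h : Kac -> W,
    [/\ linear h, forall x u, h (kac_act x u) = actW x (h u),
        forall m, h (m, 0) = f m &
        forall h' : Kac -> W, linear h' ->
          (forall x u, h' (kac_act x u) = actW x (h' u)) ->
          (forall m, h' (m, 0) = f m) -> h' =1 h].
Proof.
move=> [Wr Wl Wb] flin feq.
have f0 : f 0 = 0 by have := flin (-1) 0 0; rewrite scaler0 addr0 scaleN1r addNr.
have fZ c m : f (c *: m) = c *: f m by have := flin c m 0; rewrite f0 !addr0.
have fD m n : f (m + n) = f m + f n by have := flin 1 m n; rewrite !scale1r.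
have W0 x : actW x 0 = 0.
  by have := Wr x (-1) 0 0; rewrite scaler0 addr0 scaleN1r addNr.
have WD x u v : actW x (u + v) = actW x u + actW x v.
  by have := Wr x 1 u v; rewrite !scale1r.
have WZ x c u : actW x (c *: u) = c *: actW x u.
  by have := Wr x c u 0; rewrite W0 !addr0.
have W0l u : actW 0 u = 0.
  by have := Wl u (-1) 0 0; rewrite scaler0 addr0 scaleN1r addNr.
have WDl u x y : actW (x + y) u = actW x u + actW y u.
  by have := Wl u 1 x y; rewrite !scale1r.
have WZl u c x : actW (c *: x) u = c *: actW x u.
  by have := Wl u c x 0; rewrite W0l !addr0.
have [pg cg sg] := gammaP.
have gg u : actW gamma (actW gamma u) = 0.
  have := Wb true true gamma gamma u pg pg.
  have -> : P2_br gamma gamma = 0.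
    have [e1 e2 e3] := P2_br_submx pg pg; have dg := P2_par1 pg.
    have [_ _ _ c0] := P2_br11 pg pg.
    have ug : ursubmx (vsval gamma) = 0.
      by rewrite vsval_gamma gamma_mx_block block_mxKur.
    have z i j : (0 : 'M[F]_2) i j = 0 by rewrite mxE.
    apply: P2_coords_eq0; last split; rewrite // ?/c_h1 ?/c_h2 ?/c_alpha ?/c_beta
      ?/c_e13 ?/c_e24 ?/c_e14_23 ?e3 ?e1 dg ug ?trmx0 ?(mulmx0, mul0mx) ?oppr0
      ?addr0 ?scaler0 ?oppr0 ?addr0 ?z //.
  rewrite W0l /= expr1 scaleN1r opprK -mulr2n -scaler_nat => /esym/eqP.
  by rewrite scaler_eq0 (negPf two_neq0) => /eqP.
pose h (u : Kac) : W := f u.1 + actW gamma (f u.2).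
have hlin : linear h.
  move=> c [m n] [m' n']; rewrite /h /= !flin Wr scalerDr -!addrA; congr (_ + _).
  by rewrite addrCA.
have heven x u : P2_par false x -> h (kac_act x u) = actW x (h u).
  move=> px; have [s0 c0] := opS_even px; rewrite kac_actE s0 c0.
  case: u => m n; rewrite /h /= mulmx0 addr0 scale0r addr0 -!M_actE WD.
  rewrite feq //; congr (_ + _); rewrite fD fZ WD WZ feq //.
  have := Wb false true x gamma (f n) px pg.
  rewrite br_gamma_even // WZl /= expr0 scale1r => ->.
  by rewrite addrCA subrr addr0.
have hodd x u : P2_par true x -> h (kac_act x u) = actW x (h u).
  move=> px; have [t0 c0] := opT_odd px.
  pose s := x - c_gamma x *: gamma.
  have xE : x = c_gamma x *: gamma + s by rewrite addrC subrK.
  have cs : c_gamma s = 0.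
    have [_ _ _] := coord_lin (- c_gamma x) gamma x.
    by rewrite scaleNr addrC -/s cg mulr1 addNr.
  have ss : opS s = opS x.
    have [_ + _ _] := coord_lin (- c_gamma x) gamma x.
    by rewrite scaleNr addrC -/s sg scaler0 add0r.
  have ts : opT s = 0.
    have [+ _ _ _] := coord_lin (- c_gamma x) gamma x.
    by have [-> _] := opT_odd pg; rewrite scaleNr addrC -/s t0 scaler0 add0r.
  have ps : P2_par true s.
    apply/eqP; have /eqP px' := px; have /eqP pg' := pg.
    change (gl_part true (vsval x - c_gamma x *: vsval gamma)
      = vsval x - c_gamma x *: vsval gamma).
    rewrite -{2}px' -{2}pg' /gl_part scale_block_mx opp_block_mx add_block_mx.
    have [-> -> _] := sub_submx (vsval x) (vsval gamma) (c_gamma x).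
    by rewrite !scaler0 !subr0.
  have sf m : actW s (f m) = 0.
    by rewrite -feq // M_actE ts mulmx0 f0.
  rewrite kac_actE t0 c0; case: u => m n; rewrite /h /=.
  rewrite !mulmx0 add0r scale0r !add0r fZ WZ [in RHS]xE WDl WZl !WD gg addr0 sf.
  rewrite add0r addrC; congr (_ + _).
  have := Wb true true s gamma (f n) ps pg.
  rewrite /= expr1 scaleN1r opprK sf W0 addr0 => <-.
  have [tb _ _ cb] := P2_br11 ps pg.
  by rewrite -feq // M_actE tb cg cs scale1r scale0r addr0 ss.
exists h; split=> //.
- move=> x u; have [x0 [x1 [p0 p1 ->]]] := P2_even_odd x.
  have := kac_act_linl u 1 x0 x1; rewrite !scale1r => ->.
  have := hlin 1 (kac_act x0 u) (kac_act x1 u); rewrite !scale1r => ->.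
  by rewrite heven // hodd // WDl.
- by move=> m; rewrite /h /= f0 W0 addr0.
move=> h' h'lin h'eq h'f [m n].
have -> : (m, n) = 1 *: (m, 0) + kac_act gamma (n, 0) :> Kac.
  rewrite kac_actE cg scale1r scale1r mul0mx.
  have [-> _] := opT_odd pg.
  by congr (_, _); rewrite /= ?mulmx0 ?mul0mx ?scaler0 ?addr0 ?add0r.
rewrite h'lin h'eq !h'f scale1r /h.
rewrite kac_actE cg scale1r scale1r mul0mx /=.
have [-> _] := opT_odd pg.
by rewrite /= !mulmx0 ?mul0mx ?scaler0 ?addr0 ?add0r.
Qed.

End Kac.

(* Main.v *)
From HB Require Import structures.
Require Import Defs.
From mathcomp Require Import all_boot all_order all_algebra.
From mathcomp Require Import ring zify.

(* An even derivation takes gamma into gamma (x) M, so subtracting an inner     *)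
(* derivation one may assume that it kills gamma; it then kills g_0, and all    *)
(* that remains is a g_0-morphism from g_1 to gamma (x) M.  It is determined by *)
(* the value at the extremal vector e_24, a multiple of gamma (x) v_max, which  *)
(* can be nonzero only for b = -1 and a = -3.                                   *)
(* An odd derivation kills gamma because [gamma, gamma] = 0, and its values on  *)
(* g_1 are recovered from those on g_0 through [gamma, g_1]; what remains is a  *)
(* 1-cocycle of g_0 with values in gamma (x) M.  If h_1 + h_2 acts on gamma (x) *)
(* M by the scalar a + b + 2 <> 0, the cocycle is a coboundary.  Otherwise it   *)
(* is a cocycle of sl_2, a coboundary as soon as the Casimir scalar m (m + 2),  *)
(* m = b - a, is nonzero.  The two exceptions are m = 0, where M is trivial and *)
(* the value at h_1 + h_2 is free, and m = -2, where dim M = p - 1 and alpha    *)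
(* and beta may be sent to multiples of v_max and v_0.                          *)

Set Implicit Arguments.
Unset Strict Implicit.
Unset Printing Implicit Defensive.

Import GRing.Theory.
Local Open Scope ring_scope.

(** Each parity leaves a single obstruction to a derivation being inner. For an even one it is a
    $\mathfrak g_0$-map from $\mathfrak g_{+1}$ to $\gamma\otimes M$. As $e_{24}$ is killed by
    $\beta$ and generates $\mathfrak g_{+1}$ under $\alpha$, its image is a multiple of
    $\gamma\otimes v_{max}$; matching the weights $(0,-2)$ and $(b+1,a+1)$ forces $b=-1$, $a=-3$
    ([even_inner_of_max], [even_max]).

    For an odd one it is the class of a $\mathfrak g_0$-cocycle in $\gamma\otimes M$, since this
    cocycle determines the derivation ([odd_gamma], [odd_odd]). The central element $h_1+h_2$ acts
    by $a+b+2$ and kills the class unless $a+b=-2$ ([odd_z_neq]). Then the Casimir scalar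
    $(b-a)(b-a+2)=4(b+1)(b+2)$ kills it unless $b=-1$ or $b=-2$ ([odd_casimir]). The pairs
    $(a,b)=(-1,-1)$ and $(0,-2)$ leave one and two parameters ([odd_dim1], [odd_dim_pred]).

    For each $(a,b)$ at most one parity contributes, and [dim_H1_dual] reads the dimension off
    explicit derivations paired with dual functionals that vanish on inner derivations. *)

Lemma Hom_of_linear (F : fieldType) (L V : vectType F) (f : L -> V) :
  linear f -> exists h : 'Hom(L, V), h =1 f.
Proof.
move=> lf; pose mf := GRing.isLinear.Build F L V *:%R f lf.
pose lrf : {linear L -> V} := HB.pack f mf.
by exists (linfun lrf) => x; rewrite lfunE.
Qed.

(** * Dimension of the first cohomology from dual functionals *)

Section SuperCohomology.
Variables (F : fieldType) (L V : vectType F).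
Variables (Lpar : bool -> pred L) (Vpar : bool -> pred V).
Variables (br : L -> L -> L) (act : L -> V -> V).
Local Notation derivation := (derivation Lpar Vpar br act).
Local Notation inner := (inner Lpar Vpar act).

Hypothesis Vpar0 : forall i, Vpar i 0.
Hypothesis Vpar_lin : forall i c u v, Vpar i u -> Vpar i v -> Vpar i (c *: u + v).
Hypothesis act_lin : forall x c u v, act x (c *: u + v) = c *: act x u + act x v.

Lemma derivation0 d : derivation d 0.
Proof.
have act0 x : act x 0 = 0.
  by have := act_lin x (-1) 0 0; rewrite scaler0 addr0 scaleN1r addNr.
have z x : (0 : 'Hom(L, V)) x = 0.
  by rewrite -[0 in LHS](subrr (0 : 'Hom(L, V))) add_lfunE opp_lfunE subrr.
split=> [i x _|i j x y _ _]; first by rewrite z.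
by rewrite !z !act0 !scaler0 subrr.
Qed.

Lemma derivation_lin d (f h : 'Hom(L, V)) c :
  derivation d f -> derivation d h -> derivation d (c *: f + h).
Proof.
move=> [hf df] [hh dh]; split=> [i x px|i j x y px py].
  by rewrite add_lfunE scale_lfunE; apply: Vpar_lin; [apply: hf | apply: hh].
rewrite !add_lfunE !scale_lfunE (df i j) // (dh i j) // !act_lin.
rewrite scalerBr !scalerDr opprD !scalerA addrACA.
by rewrite ![c * _]mulrC.
Qed.

(** Rank-nullity for the map $(\psi_i)_i$ on [Der]: duality with the [X i] makes it onto, and its
    kernel is exactly [Ider]. Only the parity [d0] may carry cohomology, which is how the lemma is
    applied in every case. *)
Lemma dim_H1_dual (c : nat) (d0 : bool) (X : 'I_c -> 'Hom(L, V))
    (psi : 'I_c -> 'Hom(L, V) -> F) :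
  (forall i k f h, psi i (k *: f + h) = k * psi i f + psi i h) ->
  (forall i, derivation d0 (X i)) ->
  (forall i j, psi i (X j) = (i == j)%:R) ->
  (forall f i, inner f -> psi i f = 0) ->
  (forall f, derivation (~~ d0) f -> inner f) ->
  (forall f, derivation d0 f -> (forall i, psi i f = 0) -> inner f) ->
  \dim (H1 Lpar Vpar br act) = c.
Proof.
move=> psil dX psiX psi0 inN in0.
set D := Der Lpar Vpar br act; set I := Ider Lpar Vpar br act.
pose Psi (f : 'Hom(L, V)) : 'rV[F]_c := \row_i psi i f.
have [|lP lPE] := @Hom_of_linear F 'Hom(L, V) 'rV[F]_c Psi.
  by move=> k f h; apply/rowP => i; rewrite !mxE psil.
have Ik : (I <= lker lP)%VS.
  apply: lspan_subv => f [_ inf]; rewrite memv_ker lPE.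
  by apply/eqP/rowP => i; rewrite !mxE psi0.
pose lc (r : 'rV[F]_c) := \sum_i r 0 i *: X i.
have lc_lin k r s : lc (k *: r + s) = k *: lc r + lc s.
  rewrite /lc scaler_sumr -big_split; apply: eq_bigr => i _ /=.
  by rewrite !mxE scalerDl scalerA.
have dlc r : derivation d0 (lc r).
  rewrite /lc; elim/big_rec: _ => [|i f _ df]; first exact: derivation0.
  exact: derivation_lin.
have Plc r : Psi (lc r) = r.
  rewrite -lPE linear_sum; apply/rowP => j; rewrite summxE.
  rewrite (bigD1 j) //= big1 ?addr0 => [|i nij];
    rewrite linearZ /= lPE !mxE psiX ?eqxx ?mulr1 //.
  by rewrite eq_sym (negPf nij) mulr0.
(* Made linear so that [DI] need only be tested on the homogeneous generators of [D]: the preimage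
   of [I] under [h] is a subspace. *)
have [|h hE] := @Hom_of_linear F 'Hom(L, V) 'Hom(L, V) (fun f => f - lc (Psi f)).
  move=> k f g /=; rewrite -!lPE linearP lc_lin scalerBr opprD !addrA.
  by rewrite -!addrA; congr (_ + _); rewrite addrCA.
have DI f : f \in D -> f - lc (Psi f) \in I.
  rewrite -hE memv_preim; move: f; apply: (subvP (lspan_subv _)) => {}f [d df].
  rewrite -memv_preim hE.
  have [dd|nd] := eqVneq d d0; last first.
    have {}nd : d = ~~ d0 by case: d nd {df}; case: (d0).
    have inf : inner f by apply: inN; rewrite -nd.
    have -> : Psi f = 0 by apply/rowP => i; rewrite !mxE psi0.
    rewrite /lc big1 ?subr0 => [|i _]; last by rewrite mxE scale0r.
    by apply: mem_lspan; split=> //; exists d.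
  have dfl : derivation d0 (f - lc (Psi f)).
    rewrite addrC -scaleN1r; apply: derivation_lin => //; rewrite -?dd //.
  apply: mem_lspan; split; first by exists d0.
  apply: in0 => // i; have := congr1 (fun r : 'rV_c => r 0 i) (Plc (Psi f)).
  rewrite addrC -scaleN1r psil !mxE => ->.
  by rewrite mulN1r addNr.
have DkI : (D :&: lker lP = I)%VS.
  apply/eqP; rewrite eqEsubv subv_cap Ik Ider_sub_Der !andbT.
  apply/subvP => f; rewrite memv_cap memv_ker lPE => /andP[fD /eqP Pf].
  move: (DI f fD); rewrite Pf /lc big1 ?subr0 // => i _.
  by rewrite mxE scale0r.
have imD : (lP @: D = fullv)%VS.
  apply/eqP; rewrite eqEsubv subvf; apply/subvP => r _.
  rewrite -(Plc r) -lPE memv_img //; apply: mem_lspan.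
  by exists d0; apply: dlc.
have dimc : \dim {:'rV[F]_c} = c by rewrite dimvf dim_matrix; apply: mul1n.
have := limg_ker_dim lP D; rewrite DkI imD dimc addnC.
by rewrite -(dim_H1 Lpar Vpar br act) => /eqP; rewrite eqn_add2r => /eqP <-.
Qed.

End SuperCohomology.

(** * Coordinates and bracket table of $\tilde P(2)$ *)

Section P2Elements.
Variable F : fieldType.
Local Notation g := (P2 F).

Definition coord2 (d00 d01 d10 d11 : F) : 'M[F]_2 :=
  \matrix_(i, j) if i == 0 then (if j == 0 then d00 else d01)
                 else (if j == 0 then d10 else d11).

(* The arguments are the coordinates along h_1, h_2, alpha, beta, e_13, e_24,   *)
(* e_14 + e_23 and gamma, in this order.                                        *)
Definition P2_elt (h1 h2 al be s t u c : F) : g :=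
  vsproj (P2_space F) (block_mx (- (coord2 h1 be al h2)^T) (coord2 s u u t)
                                (coord2 0 (- c) c 0) (coord2 h1 be al h2)).

Lemma vsval_P2_elt h1 h2 al be s t u c :
  vsval (P2_elt h1 h2 al be s t u c) =
    block_mx (- (coord2 h1 be al h2)^T) (coord2 s u u t)
             (coord2 0 (- c) c 0) (coord2 h1 be al h2).
Proof.
rewrite vsprojK //; apply/mem_P2.
rewrite !(block_mxKul, block_mxKur, block_mxKdl, block_mxKdr); split.
- by apply/matrixP => i j; rewrite !mxE opprK.
- by apply/matrixP; elim/ord2P; elim/ord2P; rewrite !mxE.
- by apply/matrixP; elim/ord2P; elim/ord2P; rewrite !mxE /= ?oppr0 ?opprK.
Qed.

Lemma P2_eltE h1 h2 al be s t u c (x := P2_elt h1 h2 al be s t u c) :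
  ((c_h1 x = h1) * (c_h2 x = h2) * (c_alpha x = al) * (c_beta x = be)) *
  ((c_e13 x = s) * (c_e24 x = t) * (c_e14_23 x = u) * (c_gamma x = c)).
Proof.
rewrite /c_h1 /c_h2 /c_alpha /c_beta /c_e13 /c_e24 /c_e14_23 /c_gamma.
by rewrite vsval_P2_elt !(block_mxKur, block_mxKdl, block_mxKdr) !mxE.
Qed.

Lemma P2_elt_even h1 h2 al be : P2_par false (P2_elt h1 h2 al be 0 0 0 0).
Proof.
have z : coord2 0 0 0 0 = 0 by apply/matrixP; elim/ord2P; elim/ord2P; rewrite !mxE.
rewrite /P2_par vsval_P2_elt /gl_part !(block_mxKul, block_mxKdr).
by rewrite oppr0 !z.
Qed.

Lemma P2_elt_odd s t u c : P2_par true (P2_elt 0 0 0 0 s t u c).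
Proof.
have z : coord2 0 0 0 0 = 0 by apply/matrixP; elim/ord2P; elim/ord2P; rewrite !mxE.
rewrite /P2_par vsval_P2_elt /gl_part !(block_mxKur, block_mxKdl).
by rewrite !z trmx0 oppr0.
Qed.

Lemma P2_even_coords (x : g) : P2_par false x ->
  (c_e13 x = 0) * (c_e24 x = 0) * (c_e14_23 x = 0) * (c_gamma x = 0).
Proof.
move=> /P2_par0[bx cx]; rewrite /c_e13 /c_e24 /c_e14_23 /c_gamma bx cx.
by rewrite !mxE.
Qed.

Lemma P2_odd_coords (x : g) : P2_par true x ->
  (c_h1 x = 0) * (c_h2 x = 0) * (c_alpha x = 0) * (c_beta x = 0).
Proof.
by move=> /P2_par1 dx; rewrite /c_h1 /c_h2 /c_alpha /c_beta dx !mxE.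
Qed.

Hypothesis two_neq0 : 2%:R != 0 :> F.

Lemma P2_eqP (x y : g) :
  [/\ c_h1 x = c_h1 y, c_h2 x = c_h2 y, c_alpha x = c_alpha y
    & c_beta x = c_beta y] ->
  [/\ c_e13 x = c_e13 y, c_e24 x = c_e24 y, c_e14_23 x = c_e14_23 y
    & c_gamma x = c_gamma y] -> x = y.
Proof.
move=> [h1 h2 h3 h4] [h5 h6 h7 h8]; apply/val_inj.
by rewrite /= (P2_coordE x two_neq0) (P2_coordE y two_neq0) h1 h2 h3 h4 h5 h6 h7 h8.
Qed.

Lemma P2_eltK (x : g) :
  x = P2_elt (c_h1 x) (c_h2 x) (c_alpha x) (c_beta x)
             (c_e13 x) (c_e24 x) (c_e14_23 x) (c_gamma x).
Proof. by apply: P2_eqP; rewrite !P2_eltE. Qed.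

Lemma scomm_submx (X Y : 'M[F]_(2 + 2)) :
  [/\ ursubmx (scomm X Y) =
        ulsubmx X *m ursubmx Y + ursubmx X *m drsubmx Y
        - (ulsubmx Y *m ursubmx X + ursubmx Y *m drsubmx X),
      dlsubmx (scomm X Y) =
        dlsubmx X *m ulsubmx Y + drsubmx X *m dlsubmx Y
        - (dlsubmx Y *m ulsubmx X + drsubmx Y *m dlsubmx X) &
      drsubmx (scomm X Y) =
        dlsubmx X *m ursubmx Y + dlsubmx Y *m ursubmx X
        + (drsubmx X *m drsubmx Y - drsubmx Y *m drsubmx X)].
Proof.
rewrite /scomm !big_bool /gl_part /= !mulmx_block !scale_block_mx !opp_block_mx.
rewrite !add_block_mx !(block_mxKur, block_mxKdl, block_mxKdr).
rewrite !(mulmx0, mul0mx, scaler0, add0r, addr0, oppr0, expr0, expr1, scale1r).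
rewrite ?scaleN1r ?opprK; split.
- by rewrite [X in _ = X - _]addrC opprD [RHS]addrACA.
- by rewrite [X in _ = _ - X]addrC opprD [RHS]addrACA.
- by [].
Qed.
(** Valid for arbitrary, not only homogeneous, arguments: the supercommutator is bilinear, and its
    sign shows up only as the symmetric $\gamma$-terms. Packed as one rewrite rule, it reduces
    bracket identities to [ring]. *)
Lemma P2_brE (x y : g) (z := P2_br x y) :
  ((c_h1 z = c_beta x * c_alpha y - c_beta y * c_alpha x
             - c_gamma x * c_e14_23 y - c_gamma y * c_e14_23 x)
  *(c_h2 z = c_alpha x * c_beta y - c_alpha y * c_beta x
             + c_gamma x * c_e14_23 y + c_gamma y * c_e14_23 x)
  *(c_alpha z = (c_h2 x - c_h1 x) * c_alpha y - (c_h2 y - c_h1 y) * c_alpha x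
             + c_gamma x * c_e13 y + c_gamma y * c_e13 x)
  *(c_beta z = (c_h1 x - c_h2 x) * c_beta y - (c_h1 y - c_h2 y) * c_beta x
             - c_gamma x * c_e24 y - c_gamma y * c_e24 x))
 *((c_e13 z = 2%:R * (c_h1 y * c_e13 x + c_alpha y * c_e14_23 x)
              - 2%:R * (c_h1 x * c_e13 y + c_alpha x * c_e14_23 y))
  *(c_e24 z = 2%:R * (c_h2 y * c_e24 x + c_beta y * c_e14_23 x)
              - 2%:R * (c_h2 x * c_e24 y + c_beta x * c_e14_23 y))
  *(c_e14_23 z =
      ctr y * c_e14_23 x + c_beta y * c_e13 x + c_alpha y * c_e24 x
      - (ctr x * c_e14_23 y + c_beta x * c_e13 y + c_alpha x * c_e24 y))
  *(c_gamma z = ctr x * c_gamma y - ctr y * c_gamma x)).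
Proof.
have sym (w : g) : [/\ ursubmx (vsval w) 1 0 = ursubmx (vsval w) 0 1,
    dlsubmx (vsval w) 0 1 = - dlsubmx (vsval w) 1 0,
    dlsubmx (vsval w) 0 0 = 0 & dlsubmx (vsval w) 1 1 = 0].
  have /mem_P2[_ /matrixP/(_ 1 0) hB /matrixP/(_ 0 1) hC] := subvsP w.
  by split; rewrite ?dlsubmx_diag0 // [LHS](hB, hC) !mxE.
have mul2E (P Q : 'M[F]_2) i j : (P *m Q) i j = P i 0 * Q 0 j + P i 1 * Q 1 j.
  rewrite !mxE big_ord_recl big_ord1; congr (_ + _ * _); congr (_ _ _);
  exact: val_inj.
have subE (P Q : 'M[F]_2) i j : (P - Q) i j = P i j - Q i j by rewrite !mxE.
have addE (P Q : 'M[F]_2) i j : (P + Q) i j = P i j + Q i j by rewrite !mxE.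
have oppE (P : 'M[F]_2) i j : (- P^T) i j = - P j i by rewrite !mxE.
have [e1 e2 e3] := scomm_submx (vsval x) (vsval y).
rewrite /ctr /c_gamma /c_h1 /c_h2 /c_alpha /c_beta /c_e13 /c_e24 /c_e14_23.
rewrite /z vsval_P2_br e1 e2 e3 !P2_ul.
move: (sym x) (sym y).
move: (drsubmx (vsval x)) (ursubmx (vsval x)) (dlsubmx (vsval x)).
move: (drsubmx (vsval y)) (ursubmx (vsval y)) (dlsubmx (vsval y)).
move=> C' B' D' C B D [h1 h2 h3 h4] [h5 h6 h7 h8].
rewrite !(subE, addE, mul2E, oppE) h1 h2 h3 h4 h5 h6 h7 h8.
by repeat split; ring.
Qed.
End P2Elements.

(** Unlike [mxE], this leaves products of matrices folded, so that [ring] treats their entries as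
    atoms. *)
Lemma mx_linE (R : pzRingType) m n :
  (forall (A B : 'M[R]_(m, n)) i j, (A + B) i j = A i j + B i j) *
   (forall (A : 'M[R]_(m, n)) i j, (- A) i j = - A i j) *
   (forall k (A : 'M[R]_(m, n)) i j, (k *: A) i j = k * A i j) *
   (forall i j, (0 : 'M[R]_(m, n)) i j = 0).
Proof. by do !split; move=> *; rewrite !mxE. Qed.

(** * Whitehead's lemma for $\mathfrak{sl}_2$, with [H], [P], [Q] in the roles of $h_2-h_1$,
    $\alpha$, $\beta$ *)

Section Casimir.
Variables (F : fieldType) (n : nat) (H P Q : 'M[F]_n) (s : F).
Hypothesis HP : H *m P = P *m H - 2%:R *: P.
Hypothesis HQ : H *m Q = Q *m H + 2%:R *: Q.
Hypothesis QP : Q *m P = P *m Q + H.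
Hypothesis cas : H *m H + 2%:R *: (P *m Q) + 2%:R *: (Q *m P) = s%:M.
Hypothesis s0 : s != 0.

Let casE (t : 'rV[F]_n) :
  s *: t = t *m H *m H + 2%:R *: (t *m P *m Q) + 2%:R *: (t *m Q *m P).
Proof.
have := congr1 (mulmx t) cas; rewrite mul_mx_scalar => <-.
by rewrite !mulmxDr -!scalemxAr !mulmxA.
Qed.

(** The Casimir element kills an invariant vector but acts by [s], which is nonzero. *)
Lemma sl2_invariant0 (z : 'rV[F]_n) :
  z *m P = 0 -> z *m Q = 0 -> z *m H = 0 -> z = 0.
Proof.
move=> zP zQ zH; apply/eqP; have := casE z.
rewrite zP zQ zH !mul0mx !scaler0 !addr0 => /eqP.
by rewrite scaler_eq0 (negPf s0).
Qed.

(* The standard homotopy: a cocycle d is the coboundary of s^-1 sum x_i d(x^i), *)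
(* where sum x_i x^i = H^2 + 2PQ + 2QP is the Casimir element.                  *)
Lemma sl2_cocycle_inner (A B C : 'rV[F]_n) :
  A *m H = 2%:R *: A + C *m P -> B *m H = C *m Q - 2%:R *: B ->
  B *m P = C + A *m Q ->
  exists m : 'rV[F]_n, [/\ C = m *m H, A = m *m P & B = m *m Q].
Proof.
move=> rA rB rC.
have mHP (t : 'rV[F]_n) : t *m H *m P = t *m P *m H - 2%:R *: (t *m P).
  by rewrite -!mulmxA HP mulmxBr -scalemxAr.
have mHQ (t : 'rV[F]_n) : t *m H *m Q = t *m Q *m H + 2%:R *: (t *m Q).
  by rewrite -!mulmxA HQ mulmxDr -scalemxAr.
have mQP (t : 'rV[F]_n) : t *m Q *m P = t *m P *m Q + t *m H.
  by rewrite -!mulmxA QP mulmxDr.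
have mPH (t : 'rV[F]_n) : t *m P *m H = t *m H *m P + 2%:R *: (t *m P).
  by rewrite mHP subrK.
have mQH (t : 'rV[F]_n) : t *m Q *m H = t *m H *m Q - 2%:R *: (t *m Q).
  by rewrite mHQ addrK.
(* In the dual bases $\alpha$ pairs with $\beta$ and $h$ with itself, hence [B] is acted on by [P]
   and [A] by [Q]. *)
exists (s^-1 *: (C *m H + 2%:R *: (B *m P) + 2%:R *: (A *m Q))).
have sK (t u : 'rV[F]_n) : s *: t = u -> t = s^-1 *: u.
  by move=> <-; rewrite scalerA mulVf // scale1r.
have mulE c (X Y Z : 'rV[F]_n) (M : 'M[F]_n) :
    (c *: (X + 2%:R *: Y + 2%:R *: Z)) *m M =
    c *: (X *m M + 2%:R *: (Y *m M) + 2%:R *: (Z *m M)).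
  by rewrite -scalemxAl !mulmxDl -!scalemxAl.
have addM (X Y : 'rV[F]_n) (M : 'M[F]_n) : (X + Y) *m M = X *m M + Y *m M.
  exact: mulmxDl.
have oppM (X : 'rV[F]_n) (M : 'M[F]_n) : (- X) *m M = - (X *m M).
  exact: mulNmx.
have sclM c (X : 'rV[F]_n) (M : 'M[F]_n) : (c *: X) *m M = c *: (X *m M).
  by rewrite -scalemxAl.
pose mE := (addM, oppM, sclM).
split; rewrite mulE; apply: sK; rewrite casE.
- rewrite mPH mQH rA rB !mE.
  by apply/rowP => j; rewrite !mx_linE; ring.
- rewrite rA rC !mE mHP mQP rA.
  by apply/rowP => j; rewrite !mx_linE; ring.
- have rC' : A *m Q = B *m P - C by rewrite rC addrAC subrr add0r.
  rewrite rC' mQP rB !mE mHQ rB.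
  by apply/rowP => j; rewrite !mx_linE; ring.
Qed.
End Casimir.

Section P2Coordinates.
Variable F : fieldType.

Lemma P2_coord_lin k (x y : P2 F) (z := k *: x + y) :
  ((c_h1 z = k * c_h1 x + c_h1 y) * (c_h2 z = k * c_h2 x + c_h2 y) *
   (c_alpha z = k * c_alpha x + c_alpha y) *
   (c_beta z = k * c_beta x + c_beta y)) *
  ((c_e13 z = k * c_e13 x + c_e13 y) * (c_e24 z = k * c_e24 x + c_e24 y) *
   (c_e14_23 z = k * c_e14_23 x + c_e14_23 y) *
   (c_gamma z = k * c_gamma x + c_gamma y)).
Proof.
have zE : vsval z = k *: vsval x + vsval y by [].
rewrite /c_h1 /c_h2 /c_alpha /c_beta /c_e13 /c_e24 /c_e14_23 /c_gamma zE.
by rewrite !mxE.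
Qed.

Lemma P2_coord_scale k (x : P2 F) (z := k *: x) :
  ((c_h1 z = k * c_h1 x) * (c_h2 z = k * c_h2 x) *
   (c_alpha z = k * c_alpha x) * (c_beta z = k * c_beta x)) *
  ((c_e13 z = k * c_e13 x) * (c_e24 z = k * c_e24 x) *
   (c_e14_23 z = k * c_e14_23 x) * (c_gamma z = k * c_gamma x)).
Proof.
have zE : vsval z = k *: vsval x by [].
rewrite /c_h1 /c_h2 /c_alpha /c_beta /c_e13 /c_e24 /c_e14_23 /c_gamma zE.
by rewrite !mxE.
Qed.

End P2Coordinates.

(** * Weight coordinates on the Kac module and even derivations *)

Section KacCohomology.
Variables (F : fieldType) (p : nat) (a b : 'F_p).
Local Notation g := (P2 F).
Local Notation K := (Kac F a b).
Local Notation n := (kdim a b).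
Local Notation aF := ((Phi a)%:R : F).
Local Notation bF := ((Phi b)%:R : F).
Local Notation Ma := (M_alpha F a b).
Local Notation Mb := (M_beta F a b).
Local Notation M1 := (M_h1 F a b).
Local Notation M2 := (M_h2 F a b).
Local Notation v_ := (v_ F a b).
Local Notation derivation :=
  (derivation (@P2_par F) (@kac_par F p a b) (@P2_br F) (@kac_act F p a b)).
Local Notation inner := (inner (@P2_par F) (@kac_par F p a b) (@kac_act F p a b)).
Local Notation opT := (@opT F p a b).
Local Notation opS := (@opS F p a b).

Local Notation xh1 := (P2_elt (F := F) 1 0 0 0 0 0 0 0).
Local Notation xh2 := (P2_elt (F := F) 0 1 0 0 0 0 0 0).
Local Notation xalpha := (P2_elt (F := F) 0 0 1 0 0 0 0 0).
Local Notation xbeta := (P2_elt (F := F) 0 0 0 1 0 0 0 0).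
Local Notation xe13 := (P2_elt (F := F) 0 0 0 0 1 0 0 0).
Local Notation xe24 := (P2_elt (F := F) 0 0 0 0 0 1 0 0).
Local Notation xe14_23 := (P2_elt (F := F) 0 0 0 0 0 0 1 0).
Local Notation xgamma := (P2_elt (F := F) 0 0 0 0 0 0 0 1).

Lemma mulmx_h1 (t : 'rV[F]_n) (k : 'I_n) : (t *m M1) 0 k = t 0 k * (aF + k%:R).
Proof.
rewrite !mxE (bigD1 k) //= big1 => [|j jk]; rewrite !mxE ?eqxx ?mulr1 ?addr0 //.
by rewrite val_eqE eq_sym (negPf jk) !mulr0.
Qed.

Lemma mulmx_h2 (t : 'rV[F]_n) (k : 'I_n) : (t *m M2) 0 k = t 0 k * (bF - k%:R).
Proof.
rewrite !mxE (bigD1 k) //= big1 => [|j jk]; rewrite !mxE ?eqxx ?mulr1 ?addr0 //.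
by rewrite val_eqE eq_sym (negPf jk) !mulr0.
Qed.

Lemma mulmx_MH (t : 'rV[F]_n) (k : 'I_n) :
  (t *m (M2 - M1)) 0 k = t 0 k * (bF - aF - 2%:R * k%:R).
Proof.
by rewrite mulmxBr !mx_linE mulmx_h1 mulmx_h2; ring.
Qed.

(** $\alpha$ lowers the index, so it never reaches $v_{max}$; likewise $\beta$ never reaches $v_0$.
    These two coordinates later detect non-inner derivations. *)
Lemma mulmx_alpha_max (t : 'rV[F]_n) : (t *m Ma) 0 ord_max = 0.
Proof.
rewrite !mxE big1 // => -[[|j] ltj] _; rewrite !mxE /= ?mul0r ?mulr0 //.
by rewrite gtn_eqF // !mulr0.
Qed.

Lemma mulmx_beta0 (t : 'rV[F]_n) : (t *m Mb) 0 ord0 = 0.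
Proof. by rewrite !mxE big1 // => j _; rewrite !mxE /= mulr0. Qed.

Lemma ker_beta (t : 'rV[F]_n) : t *m Mb = 0 -> t = t 0 ord_max *: v_ n.-1.
Proof.
move=> tb; apply/rowP => j; rewrite !mxE /=.
have [jm|jm] := eqVneq (j : nat) (Phi (b - a)).
  by rewrite mulr1; congr (t _ _); apply: val_inj.
have ltj : (j.+1 < n)%N by rewrite ltnS ltn_neqAle jm -ltnS ltn_ord.
rewrite mulr0; have /rowP/(_ (Ordinal ltj)) := tb.
rewrite !mxE (bigD1 j) //= big1 ?addr0 => [|i ij]; rewrite !mxE /= ?eqxx ?mulr1 //.
by rewrite eqSS val_eqE eq_sym (negPf ij) mulr0.
Qed.

Lemma kac_par0 d : @kac_par F p a b d 0.
Proof. by case: d; rewrite /kac_par /= eqxx. Qed.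

Lemma kac_par_lin d c (u v : K) : kac_par d u -> kac_par d v -> kac_par d (c *: u + v).
Proof. by case: d => /= /eqP u0 /eqP v0; rewrite u0 v0 scaler0 addr0. Qed.

Hypothesis pcharFp : p \in [pchar F].
Hypothesis p_gt2 : (2 < p)%N.
Let two0 : 2%:R != 0 :> F := two_neq0 pcharFp p_gt2.

Ltac P2_eq0 := apply: (P2_eqP two0);
  rewrite ?P2_coord_lin ?P2_coord_scale ?P2_eltE; split; ring.

Ltac P2_eq := apply: (P2_eqP two0);
  rewrite !(P2_brE two0) ?P2_coord_scale /ctr ?P2_eltE; split; ring.

Lemma br_xgamma_even (x : g) : P2_par false x -> P2_br x xgamma = ctr x *: xgamma.
Proof.
move=> px; apply: (P2_eqP two0); rewrite !(P2_brE two0) ?P2_coord_scale /ctr;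
  by rewrite ?P2_eltE !(P2_even_coords px); split; ring.
Qed.

(** Apply [f] to $[x,\gamma]$, a multiple of $\gamma$: the trace terms cancel, leaving $\gamma
    f(x)$, and $\gamma$ is injective on $1\otimes M$. So on $\mathfrak g_0$ the map [f] agrees with
    the inner derivation of $1\otimes n$, where $f(\gamma)=\gamma\otimes n$. *)
Lemma even_derivation_even f : derivation false f -> forall x, P2_par false x ->
  f x = ((f xgamma).2 *m opT x, 0).
Proof.
move=> [hf df] x px; have pg := P2_elt_odd 0 0 0 (1 : F).
have /eqP fx2 := hf _ _ px; have /eqP fg1 := hf _ _ pg.
have := df _ _ _ _ px pg; rewrite br_xgamma_even // !kac_actE linearZ /=.
have [tg cg] := opT_odd a b pg.
rewrite !expr0 !scale1r tg cg fg1 P2_eltE => /(congr1 snd) /=.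
rewrite fx2 !mulmx0 !scaler0 scale1r !(addr0, add0r) => /eqP.
rewrite eq_sym subr_eq [_ + ctr x *: _]addrC (inj_eq (addrI _)) => /eqP ->.
by case: (f x) fx2 => y1 y2 /= ->.
Qed.

(** This is $\mathfrak g_0$-equivariance on $\mathfrak g_{+1}$: the other term of the Leibniz rule
    vanishes because $\mathfrak g_{+1}$ kills $f(x)\in 1\otimes M$. *)
Lemma even_derivation_odd f : derivation false f -> forall x e,
  P2_par false x -> P2_par true e -> c_gamma e = 0 ->
  (f (P2_br x e)).2 = (f e).2 *m opT x + ctr x *: (f e).2.
Proof.
move=> df' x e px pe ge; have [hf df] := df'; have /eqP fe1 := hf _ _ pe.
have /eqP fx2 := hf _ _ px.
rewrite (df _ _ _ _ px pe) !kac_actE /= !expr0 !scale1r fe1 ge /=.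
have [_ ->] := opT_odd a b pe; have [-> _] := opT_odd a b pe.
by rewrite fx2 !mulmx0 !scaler0 scale0r !addr0 subr0.
Qed.

Lemma even_inner f : derivation false f ->
  (f xe13).2 = 0 -> (f xe24).2 = 0 -> (f xe14_23).2 = 0 -> inner f.
Proof.
move=> df f1 f2 f3; have [hf _] := df.
exists false, ((f xgamma).2, 0); split; first by rewrite /= eqxx.
have z13 : f xe13 = 0.
  have /eqP := hf _ _ (P2_elt_odd 1 0 0 (0 : F)).
  by case: (f _) f1 => ? ? /= -> ->.
have z24 : f xe24 = 0.
  have /eqP := hf _ _ (P2_elt_odd 0 1 0 (0 : F)).
  by case: (f _) f2 => ? ? /= -> ->.
have z14 : f xe14_23 = 0.
  have /eqP := hf _ _ (P2_elt_odd 0 0 1 (0 : F)).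
  by case: (f _) f3 => ? ? /= -> ->.
have /eqP := hf _ _ (P2_elt_odd 0 0 0 (1 : F)) => /= fg1.
case=> x px; rewrite kac_actE /= expr0 scale1r; last first.
  rewrite (even_derivation_even df px) mul0mx addr0 scaler0.
  by rewrite (P2_even_coords px) mul0mx scale0r !addr0.
have fx : f x = (0, c_gamma x *: (f xgamma).2).
  have {1}-> : x = c_e13 x *: xe13 + (c_e24 x *: xe24 +
       (c_e14_23 x *: xe14_23 + c_gamma x *: xgamma)).
    apply: (P2_eqP two0); rewrite !P2_coord_lin ?P2_coord_scale ?P2_eltE;
    by rewrite ?(P2_odd_coords px); split; ring.
  rewrite !linearP linearZ /= z13 z24 z14 !scaler0 !add0r.
  by case: (f _) fg1 => u1 u2 /= ->; rewrite -[LHS]/(_ *: _, _ *: _) scaler0.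
have [-> ->] := opT_odd a b px.
by rewrite fx !mulmx0 mul0mx scaler0 !add0r.
Qed.

Lemma opT_elt h1 h2 al be s t u c :
  opT (P2_elt h1 h2 al be s t u c) = h1 *: M1 + h2 *: M2 + al *: Ma + be *: Mb.
Proof. by rewrite /Defs.opT !P2_eltE. Qed.

Lemma ctr_elt (h1 h2 al be s t u c : F) :
  ctr (P2_elt h1 h2 al be s t u c) = h1 + h2.
Proof. by rewrite /ctr !P2_eltE. Qed.

(** Equivariance along $[\beta,e_{24}]=0$, the weight of $e_{24}$, and the chain
    $e_{24}\mapsto-(e_{14}+e_{23})$, $e_{14}+e_{23}\mapsto-2e_{13}$ under $\alpha$. *)
Lemma even_e24 (f : 'Hom(g, K)) (t := (f xe24).2) : derivation false f ->
  [/\ t *m Mb = 0, t *m M1 + t = 0, t *m M2 + t = - 2%:R *: t,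
      (f xe14_23).2 = - (t *m Ma) & - 2%:R *: (f xe13).2 = (f xe14_23).2 *m Ma].
Proof.
move=> df.
have E h1 h2 al be e := even_derivation_odd df (P2_elt_even h1 h2 al be) (e := e).
have e24P := P2_elt_odd 0 1 0 (0 : F); have e14P := P2_elt_odd 0 0 1 (0 : F).
have g24 : c_gamma xe24 = 0 by rewrite P2_eltE.
pose simp := (@scale0r, @scale1r, @add0r, @addr0).
have g14 : c_gamma xe14_23 = 0 by rewrite P2_eltE.
split.
- have := E 0 0 0 1 _ e24P g24; rewrite opT_elt ctr_elt -/t.
  have -> : P2_br xbeta xe24 = 0 *: xe24 by P2_eq.
  by rewrite linearZ /= !simp => <-.
- have := E 1 0 0 0 _ e24P g24; rewrite opT_elt ctr_elt -/t.
  have -> : P2_br xh1 xe24 = 0 *: xe24 by P2_eq.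
  by rewrite linearZ /= !simp => <-.
- have := E 0 1 0 0 _ e24P g24; rewrite opT_elt ctr_elt -/t.
  have -> : P2_br xh2 xe24 = - 2%:R *: xe24 by P2_eq.
  by rewrite linearZ /= !simp => <-.
- have := E 0 0 1 0 _ e24P g24; rewrite opT_elt ctr_elt -/t.
  have -> : P2_br xalpha xe24 = - 1 *: xe14_23 by P2_eq.
  by rewrite linearZ /= !simp scaleN1r => <-; rewrite opprK.
- have := E 0 0 1 0 _ e14P g14; rewrite opT_elt ctr_elt.
  have -> : P2_br xalpha xe14_23 = - 2%:R *: xe13 by P2_eq.
  by rewrite linearZ /= !simp.
Qed.

Lemma even_inner_of_max f : derivation false f ->
  (f xe24).2 0 ord_max = 0 -> inner f.
Proof.
move=> df f0; have [tb _ _ t14 t13] := even_e24 df.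
have t0 : (f xe24).2 = 0 by rewrite (ker_beta tb) f0 scale0r.
have t140 : (f xe14_23).2 = 0 by rewrite t14 t0 mul0mx oppr0.
apply: even_inner => //; move: t13; rewrite t140 mul0mx => /eqP.
by rewrite scaler_eq0 oppr_eq0 (negPf two0) => /eqP.
Qed.

(** On $\gamma\otimes v_{max}$ the elements $h_1,h_2$ act by $b+1$ and $a+1$, on $e_{24}$ by $0$ and
    $-2$. *)
Lemma even_max (f : 'Hom(g, K)) (c := (f xe24).2 0 ord_max) : derivation false f ->
  c * (bF + 1) = 0 /\ c * (aF + 3%:R) = 0.
Proof.
move=> df; have [tb t1 t2 _ _] := even_e24 df.
have := congr1 (fun r : 'rV_n => r 0 ord_max) t1.
have := congr1 (fun r : 'rV_n => r 0 ord_max) t2.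
rewrite !mx_linE mulmx_h1 mulmx_h2 /= (Phi_sub a b pcharFp) -/c => e2 e1.
split; first by rewrite -e1; ring.
have -> : c * (aF + 3%:R) = c * (bF - (bF - aF)) + c - (- 2%:R * c) by ring.
by rewrite e2 subrr.
Qed.

Local Notation MH := (M2 - M1).

Lemma MH_alpha : MH *m Ma = Ma *m MH - 2%:R *: Ma.
Proof.
rewrite mulmxBl mulmxBr !(M_h1alpha a b pcharFp, M_h2alpha a b pcharFp).
rewrite scaler_nat mulr2n.
by rewrite !opprD !addrA; congr (_ - _); rewrite addrAC.
Qed.

Lemma MH_beta : MH *m Mb = Mb *m MH + 2%:R *: Mb.
Proof.
rewrite mulmxBl mulmxBr M_h1beta M_h2beta scaler_nat mulr2n.
by rewrite opprB !addrA [LHS]addrAC; congr (_ + _); rewrite addrAC.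
Qed.

Lemma v_MH k : v_ k *m MH = (bF - aF - 2%:R * k%:R) *: v_ k.
Proof. by rewrite mulmxBr v_h1 v_h2 -scalerBl; congr (_ *: _); ring. Qed.

Lemma casimir : MH *m MH + 2%:R *: (Ma *m Mb) + 2%:R *: (Mb *m Ma) =
  ((bF - aF) * (bF - aF + 2%:R))%:M.
Proof.
move: (MH) v_MH => H vH; apply: Defs.eq_op => k.
rewrite mul_mx_scalar !mulmxDr -!scalemxAr !mulmxA.
rewrite vH -scalemxAl vH v_beta !v_alpha // -scalemxAl v_beta /=.
case: k => [|k] /=.
  by rewrite mul0r !scale0r scaler0 addr0 !scalerA -scalerDl; congr (_ *: _); ring.
by rewrite !scalerA -!scalerDl; congr (_ *: _); rewrite -!natr1; ring.
Qed.

(** * Odd derivations as cocycles of $\mathfrak g_0$ in $\gamma\otimes M$ *)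

Section OddDerivation.
Variable f : 'Hom(g, K).
Hypothesis df : derivation true f.
Local Notation delta x := (f x).2.

(** $[\gamma,\gamma]=0$ gives $2\gamma f(\gamma)=0$, with $2\neq 0$ and $\gamma$ injective on
    $1\otimes M$. *)
Lemma odd_gamma : f xgamma = (0, 0).
Proof.
have [hf dd] := df; have pg := P2_elt_odd 0 0 0 (1 : F).
have /eqP fg2 := hf _ _ pg; have [tg cg] := opT_odd a b pg.
have := dd _ _ _ _ pg pg; rewrite !kac_actE.
have -> : P2_br xgamma xgamma = 0 *: xgamma by P2_eq.
rewrite linearZ /= tg cg fg2 P2_eltE => /(congr1 snd) /=.
rewrite !mulmx0 !scaler0 !add0r scale1r expr1 expr0 scaleN1r scale1r scale0r.
move=> /esym/eqP; rewrite -[X in X - _ == _]/(- (f xgamma).1) -opprD oppr_eq0.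
rewrite -mulr2n -scaler_nat scaler_eq0 (negPf two0) => /eqP fg1.
by case: (f xgamma) fg1 fg2 => ? ? /= -> ->.
Qed.

(** As $f(\gamma)=0$, the Leibniz rule on $[\gamma,x]$ leaves only $-\gamma f(x)$, which determines
    $f(x)\in 1\otimes M$. *)
Lemma odd_odd x : P2_par true x -> f x = (- delta (P2_br xgamma x), 0).
Proof.
move=> px; have [hf dd] := df; have pg := P2_elt_odd 0 0 0 (1 : F).
have /eqP fx2 := hf _ _ px.
have [tg cg] := opT_odd a b pg; have [tx cx] := opT_odd a b px.
have := congr1 snd (dd _ _ _ _ pg px).
rewrite odd_gamma !kac_actE tg cg tx cx P2_eltE fx2 /= => ->.
rewrite !mulmx0 ?mul0mx ?scaler0 ?add0r ?expr1 ?expr0.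
rewrite ?scale1r ?scaleN1r ?scale1r ?subr0.
by rewrite opprK; case: (f x) fx2 => ? ? /= ->.
Qed.

Lemma odd_cocycle x y : P2_par false x -> P2_par false y ->
  delta (P2_br x y) = delta y *m opT x + ctr x *: delta y
                      - (delta x *m opT y + ctr y *: delta x).
Proof.
move=> px py; have [_ dd] := df.
rewrite (dd _ _ _ _ px py) !kac_actE /= !expr0 !scale1r.
by rewrite !(P2_even_coords px, P2_even_coords py) !scale0r !addr0.
Qed.

Lemma even_of_coords (x : g) :
  [/\ c_e13 x = 0, c_e24 x = 0, c_e14_23 x = 0 & c_gamma x = 0] ->
  P2_par false x.
Proof.
by move=> [h1 h2 h3 h4]; rewrite (P2_eltK two0 x) h1 h2 h3 h4 P2_elt_even.
Qed.

Lemma odd_inner (m : 'rV[F]_n) :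
  (forall x, P2_par false x -> delta x = m *m opT x + ctr x *: m) -> inner f.
Proof.
move=> dm; exists true, (0, m); split; first by rewrite /= eqxx.
have [hf _] := df.
case=> x px; rewrite kac_actE /= ?expr0 ?expr1; last first.
  have [-> gx] := opS_even a b px; have /eqP fx1 := hf _ _ px.
  rewrite scale1r !mulmx0 !mul0mx scaler0 !addr0 -dm //.
  by case: (f x) fx1 => ? ? /= ->.
have pg := P2_elt_odd 0 0 0 (1 : F); have [tx cx] := opT_odd a b px.
have [br1 _ br2 _] := P2_br11 a b pcharFp p_gt2 pg px.
rewrite odd_odd // dm; last first.
  apply: even_of_coords; rewrite !(P2_brE two0) /ctr !P2_eltE.
  by rewrite !(P2_odd_coords px); split; ring.
have gS : opS xgamma = 0 by rewrite /Defs.opS !P2_eltE !scale0r subrr addr0.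
rewrite br1 gS br2 tx cx P2_eltE scale1r scaler0 scale0r addr0 add0r.
rewrite !mul0mx !mulmx0 ?scale0r ?scaler0 ?add0r ?addr0.
by rewrite scaleN1r -[RHS]/(- _, - 0) oppr0.
Qed.

Lemma odd_inner_basis (m : 'rV[F]_n) :
  delta xh1 = m *m M1 + m -> delta xh2 = m *m M2 + m ->
  delta xalpha = m *m Ma -> delta xbeta = m *m Mb -> inner f.
Proof.
move=> d1 d2 da db; apply: (@odd_inner m) => x px.
have {1}-> : x = c_h1 x *: xh1 + (c_h2 x *: xh2 +
     (c_alpha x *: xalpha + c_beta x *: xbeta)).
  apply: (P2_eqP two0); rewrite !P2_coord_lin ?P2_coord_scale ?P2_eltE;
  by rewrite ?(P2_even_coords px); split; ring.
rewrite !linearP linearZ /= d1 d2 da db /Defs.opT /ctr.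
rewrite !mulmxDr -!scalemxAr !scalerDr scalerDl.
move: (_ *: (m *m M1)) (_ *: (m *m M2)) (_ *: (m *m Ma)) (_ *: (m *m Mb)).
move: (c_h1 x *: m) (c_h2 x *: m) => *.
by apply/rowP => j; rewrite !mxE; ring.
Qed.

(** A central element of $\mathfrak g_0$ acting by an invertible scalar makes every cocycle a
    coboundary: the cocycle identity for $h_1+h_2$ and $x$ solves for the value at $x$. *)
Lemma odd_z_neq (aFbF : aF + bF + 2%:R != 0) : inner f.
Proof.
pose m := (aF + bF + 2%:R)^-1 *: delta (P2_elt 1 1 0 0 0 0 0 0).
apply: (@odd_inner m) => x px.
have pz := P2_elt_even 1 1 0 (0 : F).
have := odd_cocycle pz px; rewrite opT_elt ctr_elt !scale0r !addr0 !scale1r.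
have -> : P2_br (P2_elt 1 1 0 0 0 0 0 0) x = 0 *: x.
  apply: (P2_eqP two0); rewrite !(P2_brE two0) ?P2_coord_scale /ctr.
    by rewrite ?P2_eltE !(P2_even_coords px); split; ring.
  by rewrite ?P2_eltE !(P2_even_coords px); split; ring.
have -> : M1 + M2 = (aF + bF)%:M.
  apply: Defs.eq_op => k; rewrite mulmxDr v_h1 v_h2 mul_mx_scalar -scalerDl.
  by congr (_ *: _); ring.
rewrite mul_mx_scalar -scalerDl linearZ /= scale0r => /esym/eqP.
rewrite subr_eq0 => /eqP e.
by rewrite /m -scalemxAl scalerA [ctr x * _]mulrC -scalerA -scalerDr -e scalerA
  mulVf ?scale1r.
Qed.

(** * The case $a+b=-2$: reduction to $\mathfrak{sl}_2$ *)

Section DegreeZero.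
Hypothesis abF : aF + bF + 2%:R = 0.
Local Notation xz := (P2_elt (F := F) 1 1 0 0 0 0 0 0).
Local Notation xh := (P2_elt (F := F) (-1) 1 0 0 0 0 0 0).
Local Notation A := (delta xalpha).
Local Notation B := (delta xbeta).
Local Notation C := (delta xh).
Local Notation Z := (delta xz).

Lemma odd_sl2 :
  [/\ A *m MH = 2%:R *: A + C *m Ma, B *m MH = C *m Mb - 2%:R *: B &
      B *m Ma = C + A *m Mb].
Proof.
have E al be h1 h2 al' be' h1' h2' := odd_cocycle
  (P2_elt_even h1 h2 al be) (P2_elt_even h1' h2' al' be').
have TH : opT xh = MH by rewrite opT_elt !scale0r scale1r scaleN1r !addr0 addrC.
pose simp := (@scale0r, @scale1r, @add0r, @addr0, @addNr).
split.
- have := E 0 0 (-1) 1 1 0 0 0; rewrite TH opT_elt !ctr_elt.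
  have -> : P2_br xh xalpha = 2%:R *: xalpha by P2_eq.
  by rewrite linearZ /= !simp => ->; rewrite subrK.
- have := E 0 0 (-1) 1 0 1 0 0; rewrite TH opT_elt !ctr_elt.
  have -> : P2_br xh xbeta = - 2%:R *: xbeta by P2_eq.
  by rewrite linearZ /= !simp scaleNr => ->; rewrite [RHS]addrC subrK.
- have := E 1 0 0 0 0 1 0 0; rewrite !opT_elt !ctr_elt.
  have -> : P2_br xalpha xbeta = xh by P2_eq.
  by rewrite !simp => ->; rewrite subrK.
Qed.

Lemma M_h1h2_scalar : M1 + M2 = (- 2%:R)%:M.
Proof.
apply: Defs.eq_op => k; rewrite mulmxDr v_h1 v_h2 mul_mx_scalar -scalerDl.
congr (_ *: _); apply/eqP; rewrite -subr_eq0 opprK -[X in _ == X]abF.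
by apply/eqP; ring.
Qed.

(** Now $h_1+h_2$ acts by zero, so the cocycle identity says that the value at this central element
    is invariant. *)
Lemma odd_z x : P2_par false x -> Z *m opT x + ctr x *: Z = 0.
Proof.
move=> px; have pz := P2_elt_even 1 1 0 (0 : F).
have := odd_cocycle pz px; rewrite opT_elt ctr_elt !scale0r !addr0 !scale1r.
have -> : P2_br xz x = 0 *: x.
  apply: (P2_eqP two0); rewrite !(P2_brE two0) ?P2_coord_scale /ctr;
    by rewrite ?P2_eltE !(P2_even_coords px); split; ring.
rewrite M_h1h2_scalar mul_mx_scalar -scalerDl addNr linearZ /= !scale0r add0r.
by move/esym/eqP; rewrite oppr_eq0 => /eqP.
Qed.

Lemma odd_inner_sl2 (m : 'rV[F]_n) :
  Z = 0 -> C = m *m MH -> A = m *m Ma -> B = m *m Mb -> inner f.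
Proof.
move=> z0 c0 a0 b0.
have two_inj (u w : 'rV[F]_n) : 2%:R *: u = 2%:R *: w -> u = w.
  by move/eqP; rewrite -subr_eq0 -scalerBr scaler_eq0 (negPf two0) subr_eq0 => /eqP.
have M12 : m *m M1 + m *m M2 = - 2%:R *: m.
  by rewrite -mulmxDr M_h1h2_scalar mul_mx_scalar.
apply: (@odd_inner_basis m) => //; apply: two_inj.
  have -> : 2%:R *: delta xh1 = Z - C.
    have {1}-> : xz = 2%:R *: xh1 + xh by P2_eq0.
    by rewrite linearD linearZ /= addrK.
  rewrite z0 c0 sub0r mulmxBr opprB.
  move/eqP: M12; rewrite addrC -subr_eq0 scaleNr opprK => /eqP M12.
  rewrite -[LHS]addr0 -M12 scalerDr scaler_nat mulr2n.
  by rewrite -!addrA; congr (_ + _); rewrite addKr.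
have -> : 2%:R *: delta xh2 = Z + C.
  have -> : Z = 2%:R *: delta xh2 - C.
    have {1}-> : xz = 2%:R *: xh2 + - 1 *: xh by P2_eq0.
    by rewrite linearD !linearZ /= scaleN1r.
  by rewrite subrK.
rewrite z0 c0 add0r mulmxBr.
move/eqP: M12; rewrite -subr_eq0 scaleNr opprK => /eqP M12.
rewrite -[LHS]addr0 -M12 scalerDr scaler_nat mulr2n.
by rewrite -!addrA; congr (_ + _); rewrite addKr.
Qed.

Lemma odd_z_ops : [/\ Z *m Ma = 0, Z *m Mb = 0 & Z *m MH = 0].
Proof.
pose simp := (@scale0r, @scale1r, @add0r, @addr0, @addNr).
split.
- have := odd_z (P2_elt_even 0 0 1 (0 : F)).
  by rewrite opT_elt ctr_elt !simp.
- have := odd_z (P2_elt_even 0 0 0 (1 : F)).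
  by rewrite opT_elt ctr_elt !simp.
- have := odd_z (P2_elt_even (-1) 1 0 (0 : F)).
  by rewrite opT_elt ctr_elt !simp scaleN1r [_ + M2]addrC.
Qed.

Lemma odd_casimir : (bF - aF) * (bF - aF + 2%:R) != 0 -> inner f.
Proof.
move=> s0; have [rA rB rC] := odd_sl2; have [zA zB zH] := odd_z_ops.
have BA := M_betaalpha a b pcharFp.
have [m [mC mA mB]] := sl2_cocycle_inner MH_alpha MH_beta BA casimir s0 rA rB rC.
apply: (odd_inner_sl2 _ mC mA mB).
exact: (sl2_invariant0 casimir s0 zA zB zH).
Qed.

(** On a one-dimensional $M$ the algebra $\mathfrak{sl}_2$ acts by zero; being perfect for $p\neq
    2$, it then admits no nonzero cocycle, and only [Z] survives. *)
Lemma odd_dim1 : Phi (b - a) = 0%N -> Z 0 ord_max = 0 -> inner f.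
Proof.
move=> ba0 z0; have [rA rB rC] := odd_sl2.
have ord1n (j : 'I_n) : j = ord_max.
  have jle : (j <= Phi (b - a)%R)%N := ltn_ord j.
  apply: val_inj; rewrite -[RHS]/(Phi (b - a)) ba0.
  by apply/eqP; rewrite -leqn0 -ba0.
have tA (t : 'rV[F]_n) : t *m Ma = 0.
  by apply/rowP => j; rewrite (ord1n j) mulmx_alpha_max mxE.
have tB (t : 'rV[F]_n) : t *m Mb = 0.
  by apply/rowP => j; rewrite (ord1n j) -(ord1n ord0) mulmx_beta0 mxE.
have tH (t : 'rV[F]_n) : t *m MH = 0.
  apply/rowP => j; rewrite mulmx_MH (ord1n j) -(ord1n ord0) /= -Phi_sub // ba0.
  by rewrite mulr0 subr0 mulr0 mxE.
apply: (@odd_inner_sl2 0); rewrite ?mul0mx.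
- by apply/rowP => j; rewrite (ord1n j) z0 mxE.
- by move: rC; rewrite tA tB addr0.
- by move/eqP: rA; rewrite tH tA addr0 eq_sym scaler_eq0 (negPf two0) => /eqP.
- move/eqP: rB; rewrite tH tB sub0r eq_sym oppr_eq0 scaler_eq0 (negPf two0).
  by move=> /eqP.
Qed.
(** Here $h=h_2-h_1$ is invertible on $M$, so its cocycle value can be made a coboundary. What is
    left at $\alpha$ and $\beta$ has $h$-weight $2$ and $-2$, hence lives on $v_{max}$ and $v_0$
    respectively. *)
Lemma odd_dim_pred : aF = 0 -> bF = - 2%:R -> Phi (b - a) = (p - 2)%N ->
  A 0 ord_max = 0 -> B 0 ord0 = 0 -> inner f.
Proof.
move=> a0 b2 ba A0 B0; have [rA rB rC] := odd_sl2.
have [_ _ zH] := odd_z_ops.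
have ltk (k : 'I_n) : (k <= p - 2)%N by rewrite -ba; exact: ltn_ord k.
have natF0 m : (0 < m < p)%N -> m%:R != 0 :> F.
  by case/andP=> m0 mp; rewrite -(dvdn_pcharf pcharFp) gtnNdvd.
(* The eigenvalue of $h$ on $v_k$ is $-2(k+1)$, and $0<k+1<p$. *)
have H0 (k : 'I_n) : bF - aF - 2%:R * k%:R != 0.
  have -> : bF - aF - 2%:R * k%:R = - (2%:R * (k.+1)%:R).
    by rewrite a0 b2 -natr1; ring.
  by rewrite oppr_eq0 mulf_neq0 // natF0 //=; have := ltk k; lia.
have kerH (t : 'rV[F]_n) : t *m MH = 0 -> t = 0.
  move=> tH; apply/rowP => k; have /rowP/(_ k) := tH; rewrite mulmx_MH !mxE.
  by move/eqP; rewrite mulf_eq0 (negPf (H0 k)) orbF => /eqP.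
pose m : 'rV[F]_n := \row_k (C 0 k / (bF - aF - 2%:R * k%:R)).
have mC : C = m *m MH.
  by apply/rowP => k; rewrite mulmx_MH !mxE divfK.
have MHa : m *m Ma *m MH = C *m Ma + 2%:R *: (m *m Ma).
  by rewrite mC -!mulmxA MH_alpha [m *m (_ - _)]mulmxBr -scalemxAr subrK.
have MHb : m *m Mb *m MH = C *m Mb - 2%:R *: (m *m Mb).
  by rewrite mC -!mulmxA MH_beta [m *m (_ + _)]mulmxDr -scalemxAr addrK.
have sclE c (t : 'rV[F]_n) k : (c *: t) 0 k = c * t 0 k by rewrite mxE.
apply: (@odd_inner_sl2 m) => //; first exact: kerH.
- apply/eqP; rewrite -subr_eq0; set A' := _ - _; apply/eqP/rowP => k.
  have A'H : A' *m MH = 2%:R *: A'.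
    rewrite mulmxBl rA MHa scalerBr opprD addrA addrK.
    by [].
  have /rowP/(_ k) := A'H; rewrite mulmx_MH sclE => /eqP.
  (* A nonzero coordinate needs $-2(k+2)=0$, and $k\le p-2$ leaves only $k=p-2$. *)
  rewrite mulrC -subr_eq0 -mulrBl mulf_eq0 => /orP[|/eqP->]; last by rewrite mxE.
  have -> : bF - aF - 2%:R * k%:R - 2%:R = - (2%:R * (k.+2)%:R).
    by rewrite a0 b2 -!natr1; ring.
  rewrite oppr_eq0 mulf_eq0 (negPf two0) /= => k2.
  have -> : k = ord_max.
    apply: val_inj; rewrite -[RHS]/(Phi (b - a)) ba; apply/eqP.
    apply: contraLR k2 => kn; rewrite natF0 //=.
    by have := ltk k; move: kn; rewrite -[X in X != _]/(nat_of_ord k); lia.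
  by rewrite !mx_linE A0 mulmx_alpha_max subr0.
- apply/eqP; rewrite -subr_eq0; set B' := _ - _; apply/eqP/rowP => k.
  have B'H : B' *m MH = - 2%:R *: B'.
    rewrite mulmxBl rB MHb scaleNr scalerBr !opprB.
    by rewrite [LHS]addrC addrA subrK.
  have /rowP/(_ k) := B'H; rewrite mulmx_MH sclE => /eqP.
  rewrite mulrC -subr_eq0 -mulrBl mulf_eq0 => /orP[|/eqP->]; last by rewrite mxE.
  have -> : bF - aF - 2%:R * k%:R - - 2%:R = - (2%:R * k%:R).
    by rewrite a0 b2; ring.
  rewrite oppr_eq0 mulf_eq0 (negPf two0) /= => k2.
  have -> : k = ord0.
    apply: val_inj => /=; apply/eqP.
    apply: contraLR k2 => kn; rewrite natF0 // lt0n kn /=.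
    by have := ltk k; lia.
  by rewrite !mx_linE B0 mulmx_beta0 subr0.
Qed.
End DegreeZero.
End OddDerivation.
End KacCohomology.

(** * Explicit derivations that are not inner *)

Section KacDerivations.
Variables (F : fieldType) (p : nat) (a b : 'F_p).
Local Notation g := (P2 F).
Local Notation K := (Kac F a b).
Local Notation aF := ((Phi a)%:R : F).
Local Notation bF := ((Phi b)%:R : F).
Local Notation v_ := (v_ F a b).
Local Notation derivation :=
  (derivation (@P2_par F) (@kac_par F p a b) (@P2_br F) (@kac_act F p a b)).

Local Notation xalpha := (P2_elt (F := F) 0 0 1 0 0 0 0 0).
Local Notation xbeta := (P2_elt (F := F) 0 0 0 1 0 0 0 0).
Local Notation xe24 := (P2_elt (F := F) 0 0 0 0 0 1 0 0).
Local Notation xz := (P2_elt (F := F) 1 1 0 0 0 0 0 0).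

Hypothesis pcharFp : p \in [pchar F].
Hypothesis p_gt2 : (2 < p)%N.
Let two0 : 2%:R != 0 :> F := two_neq0 pcharFp p_gt2.

Lemma Kac_eqP (u w : K) : u.1 = w.1 -> u.2 = w.2 -> u = w.
Proof. by case: u w => u1 u2 [w1 w2] /= -> ->. Qed.

Ltac kac_lin := move=> c x y; apply: Kac_eqP; rewrite /= ?P2_coord_lin /ctr;
  rewrite ?P2_coord_lin; apply/rowP => j; rewrite !mxE; ring.

Lemma P2_par_coords i (x : g) : P2_par i x ->
  (if i then (c_h1 x = 0) * (c_h2 x = 0) * (c_alpha x = 0) * (c_beta x = 0)
   else (c_e13 x = 0) * (c_e24 x = 0) * (c_e14_23 x = 0) * (c_gamma x = 0))%type.
Proof. by case: i => [/P2_odd_coords|/P2_even_coords]. Qed.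

Ltac kac_ring i j px py :=
  rewrite /Defs.opT /Defs.opS /ctr;
  let cx := fresh in let cy := fresh in
  move: (P2_par_coords px) (P2_par_coords py); case: i px; case: j py => _ _ /= cx cy;
  rewrite ?cx ?cy;
  rewrite ?expr0 ?expr1;
  rewrite ?(mulmxDl, mulmxBl, mulNmx, mulmxDr, mulmxBr, mulmxN, mul0mx, mulmx0);
  rewrite -?scalemxAl -?scalemxAr;
  rewrite ?(v_h1, v_h2, v_MH, v_beta, v_alpha a b pcharFp) ?succnK.

Ltac kac_fin :=
  rewrite ?(scale0r, scaler0, mul0r, mulr0, addr0, add0r, subr0, oppr0, scale1r);
  repeat match goal with
    |- context [Defs.v_ F a b ?k] => move: (Defs.v_ F a b k) => ? end;
  apply/rowP => ?;
  rewrite !mx_linE; ring.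

(** The coefficients $1,-2,2$ of the witness are those that [even_e24] forces once $e_{24}$ is sent
    to $\gamma\otimes v_2$. *)
Lemma even_derivation_ex : aF = - 3%:R -> bF = - 1 -> Phi (b - a) = 2%N ->
  exists f : 'Hom(g, K), derivation false f /\ (f xe24).2 = v_ 2.
Proof.
move=> a3 b1 ba.
have [|f fE] := @Hom_of_linear F g K (fun x =>
  (0, c_e24 x *: v_ 2 - (2%:R * c_e14_23 x) *: v_ 1 + (2%:R * c_e13 x) *: v_ 0)).
  by kac_lin.
exists f; split; last first.
  by rewrite fE /= !P2_eltE !mulr0 scale1r !scale0r subr0 addr0.
have v3 : v_ 3 = 0 by apply: v_ge; rewrite /kdim ba.
split=> [[] x px|i j x y px py]; first by rewrite fE /= eqxx.
  by rewrite fE /= !(P2_even_coords px) !mulr0 !scale0r subrr addr0.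
apply: Kac_eqP; rewrite !kac_actE !fE /= ?(P2_brE two0).
all: kac_ring i j px py. all: rewrite ?v3 a3 b1.
all: kac_fin.
Qed.
(** [ctr] is a character of $\mathfrak g_0$ and $\gamma\otimes v_0$ is $\mathfrak g_0$-invariant
    here. It vanishes on $[\gamma,\mathfrak g_{+1}]$, so the odd values are zero. *)
Lemma odd_derivation_ctr : aF = - 1 -> bF = - 1 -> Phi (b - a) = 0%N ->
  exists f : 'Hom(g, K), derivation true f /\ (f xz).2 = 2%:R *: v_ 0.
Proof.
move=> a1 b1 ba.
have [|f fE] := @Hom_of_linear F g K (fun x => (0, ctr x *: v_ 0)).
  by kac_lin.
exists f; split; last by rewrite fE /= ctr_elt.
have v1 : v_ 1 = 0 by apply: v_ge; rewrite /kdim ba.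
split=> [[] x px|i j x y px py].
- by rewrite fE /= /ctr !(P2_odd_coords px) addr0 scale0r.
- by rewrite fE /= eqxx.
apply: Kac_eqP; rewrite !kac_actE !fE /= /ctr ?(P2_brE two0).
all: kac_ring i j px py; rewrite ?v1 ?a1 ?b1.
all: kac_fin.
Qed.

Section DimPred.
Hypothesis aF0 : aF = 0.
Hypothesis bF2 : bF = - 2%:R.
Hypothesis ba : Phi (b - a) = (p - 2)%N.

Let natF_pred : (p - 2)%:R = - 2%:R :> F.
Proof. by rewrite -ba Phi_sub // aF0 bF2 subr0. Qed.

Let v_pred : v_ (p - 2).+1 = 0.
Proof. by apply: v_ge; rewrite /kdim ba. Qed.

(** The value at $e_{13}$ is dictated by [odd_odd] and $[\gamma,e_{13}]=\alpha$. In the companion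
    for $\beta$ the sign changes because $[\gamma,e_{24}]=-\beta$. *)
Lemma odd_derivation_alpha :
  exists f : 'Hom(g, K), derivation true f /\
    (f xalpha).2 = v_ (p - 2) /\ (f xbeta).2 = 0.
Proof.
have [|f fE] := @Hom_of_linear F g K
    (fun x => (- c_e13 x *: v_ (p - 2), c_alpha x *: v_ (p - 2))).
  by kac_lin.
exists f; split; last by rewrite !fE /= !P2_eltE scale1r scale0r.
split=> [[] x px|i j x y px py].
- by rewrite fE /= (P2_odd_coords px) scale0r.
- by rewrite fE /= (P2_even_coords px) oppr0 scale0r.
apply: Kac_eqP; rewrite !kac_actE !fE /= ?(P2_brE two0).
all: kac_ring i j px py; rewrite ?v_pred ?natF_pred ?aF0 ?bF2.
all: kac_fin.
Qed.

Lemma odd_derivation_beta :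
  exists f : 'Hom(g, K), derivation true f /\
    (f xalpha).2 = 0 /\ (f xbeta).2 = v_ 0.
Proof.
have [|f fE] := @Hom_of_linear F g K
    (fun x => (c_e24 x *: v_ 0, c_beta x *: v_ 0)).
  by kac_lin.
exists f; split; last by rewrite !fE /= !P2_eltE scale1r scale0r.
split=> [[] x px|i j x y px py].
- by rewrite fE /= (P2_odd_coords px) scale0r.
- by rewrite fE /= (P2_even_coords px) scale0r.
apply: Kac_eqP; rewrite !kac_actE !fE /= ?(P2_brE two0).
all: kac_ring i j px py; rewrite ?aF0 ?bF2.
all: kac_fin.
Qed.

End DimPred.
End KacDerivations.

(** * Functionals vanishing on inner derivations *)

Section InnerFunctionals.
Variables (F : fieldType) (p : nat) (a b : 'F_p).
Variable f : 'Hom(P2 F, Kac F a b).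
Hypothesis inf : inner (@P2_par F) (@kac_par F p a b) (@kac_act F p a b) f.

Lemma inner_snd_even h1 h2 al be : exists m : 'rV[F]_(kdim a b),
  (f (P2_elt h1 h2 al be 0 0 0 0)).2 =
    m *m opT a b (P2_elt h1 h2 al be 0 0 0 0) + (h1 + h2) *: m.
Proof.
have [d [v [_ fE]]] := inf; exists v.2.
rewrite (fE _ _ (P2_elt_even h1 h2 al be)) kac_actE /= expr0 scale1r.
by rewrite ctr_elt P2_eltE scale0r addr0.
Qed.

Lemma inner_e24 : (f (P2_elt 0 0 0 0 0 1 0 0)).2 = 0.
Proof.
have [d [v [_ fE]]] := inf.
rewrite (fE _ _ (P2_elt_odd 0 1 0 0)) kac_actE /=.
rewrite opT_elt ctr_elt P2_eltE !scale0r !addr0.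
by rewrite mulmx0 scale0r addr0 scaler0.
Qed.

Lemma inner_alpha_max : (f (P2_elt 0 0 1 0 0 0 0 0)).2 0 ord_max = 0.
Proof.
have [m ->] := inner_snd_even 0 0 1 0.
by rewrite opT_elt !scale0r !add0r addr0 scale1r scale0r addr0 mulmx_alpha_max.
Qed.

Lemma inner_beta0 : (f (P2_elt 0 0 0 1 0 0 0 0)).2 0 ord0 = 0.
Proof.
have [m ->] := inner_snd_even 0 0 0 1.
by rewrite opT_elt !scale0r !add0r scale1r scale0r addr0 mulmx_beta0.
Qed.

Lemma inner_z : ((Phi a)%:R + (Phi b)%:R + 2%:R : F) = 0 ->
  (f (P2_elt 1 1 0 0 0 0 0 0)).2 = 0.
Proof.
move=> abF; have [m ->] := inner_snd_even 1 1 0 0.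
rewrite opT_elt !scale0r !addr0 !scale1r M_h1h2_scalar //.
by rewrite mul_mx_scalar -scalerDl addNr scale0r.
Qed.

End InnerFunctionals.

(** * Transfer of the conditions from $\mathbb F_p$ and [Phi] to equations in $\mathbb F$ *)

Section PrimeSubfield.
Variables (F : fieldType) (p : nat).
Hypothesis pcharFp : p \in [pchar F].

Lemma natF_inj m k : (m < p)%N -> (k < p)%N -> (m%:R == k%:R :> F) = (m == k).
Proof.
wlog le_mk : m k / (m <= k)%N.
  move=> wl mp kp; case: (leqP m k) => [mk|/ltnW km]; first exact: wl.
  by rewrite eq_sym wl // eq_sym.
move=> mp kp; rewrite eq_sym -subr_eq0 -natrB // -(dvdn_pcharf pcharFp).
apply/idP/eqP => [|->]; last by rewrite subnn dvdn0.
case: (posnP (k - m)) => [|km0 /dvdn_leq]; first by lia.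
by move/(_ km0); lia.
Qed.

Lemma Phi_lt (c : 'F_p) : (Phi c < p)%N.
Proof.
have pr : prime p by case/andP: pcharFp.
by rewrite -[X in (_ < X)%N](Fp_cast pr); apply: ltn_ord.
Qed.

Lemma Phi_nat m : (Phi (m%:R : 'F_p))%:R = m%:R :> F.
Proof.
have pr : prime p by case/andP: pcharFp.
have p0 : p%:R = 0 :> F by apply/eqP; case/andP: pcharFp.
rewrite /Phi val_Fp_nat // [in RHS](divn_eq m p) natrD natrM p0 mulr0.
by rewrite add0r.
Qed.

Lemma Phi_add_eqN (c d : 'F_p) m :
  (c + d == - m%:R) = ((Phi c)%:R + (Phi d)%:R + m%:R == 0 :> F).
Proof.
have PhiB (x y : 'F_p) : (Phi (x - y))%:R = (Phi x)%:R - (Phi y)%:R :> F.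
  exact: Phi_sub.
have PhiD (x y : 'F_p) : (Phi (x + y))%:R = (Phi x)%:R + (Phi y)%:R :> F.
  by apply/eqP; rewrite -subr_eq -PhiB addrK.
have PhiE (x y : 'F_p) : (x == y) = ((Phi x)%:R == (Phi y)%:R :> F).
  by rewrite natF_inj ?Phi_lt.
have Phi0 : (Phi (0 : 'F_p))%:R = 0 :> F by have := Phi_nat 0.
by rewrite -addr_eq0 PhiE !PhiD Phi_nat Phi0.
Qed.

Lemma Phi_eq_sub (c : 'F_p) m : (0 < m <= p)%N ->
  (Phi c == p - m)%N = ((Phi c)%:R + m%:R == 0 :> F).
Proof.
have p0 : p%:R = 0 :> F by apply/eqP; case/andP: pcharFp.
case/andP=> m0 mp; rewrite -natF_inj ?Phi_lt //; last by lia.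
by rewrite natrB // p0 sub0r -addr_eq0.
Qed.

End PrimeSubfield.

(** * Assembly by cases on $(a,b)$ *)

Theorem theorem5p1 (F : fieldType) (p : nat) (pcharFp : p \in [pchar F])
    (p_gt2 : (2 < p)%N) (a b : 'F_p) :
  \dim (kac_H1 F a b) =
    if (a + b == - 2%:R) && (Phi b == (p - 2)%N) then 2%N
    else if ((a + b == - 2%:R) || (a + b == - 4%:R)) && (Phi b == (p - 1)%N)
    then 1%N
    else 0%N.
Proof.
have two0 : 2%:R != 0 :> F := two_neq0 pcharFp p_gt2.
rewrite !(Phi_add_eqN pcharFp) !(Phi_eq_sub pcharFp); try lia.
have eqFN (x y : F) : x + y = 0 -> x = - y by move/eqP; rewrite addr_eq0 => /eqP.
have PhiBE k : (k < p)%N -> (Phi b)%:R - (Phi a)%:R = k%:R :> F ->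
    Phi (b - a) = k.
  move=> kp; rewrite -Phi_sub // => /eqP.
  by rewrite (natF_inj pcharFp) ?(Phi_lt pcharFp) // => /eqP.
have vE k (j : 'I_(kdim a b)) : v_ F a b k 0 j = (j == k :> nat)%:R by rewrite mxE.
have dimE := dim_H1_dual (Lpar := @P2_par F) (br := @P2_br F)
  (@kac_par0 F p a b) (@kac_par_lin F p a b) (@kac_act_linr F p a b).
rewrite /kac_H1.
have even_in := even_inner_of_max pcharFp p_gt2.
have even_mx := even_max pcharFp p_gt2.
case: ifPn => [/andP[/eqP e1 /eqP e2]|nP1].
  have bF : (Phi b)%:R = - 2%:R :> F by apply: eqFN.
  have aF : (Phi a)%:R = 0 :> F by rewrite bF addrNK in e1.
  have ba : Phi (b - a) = (p - 2)%N.
    apply: PhiBE; first by lia.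
    have p0 : p%:R = 0 :> F by apply/eqP; case/andP: pcharFp.
    by rewrite natrB ?p0 ?aF ?bF ?subr0 ?sub0r //; lia.
  have [X1 [dX1 [X1a X1b]]] := odd_derivation_alpha pcharFp p_gt2 aF bF ba.
  have [X2 [dX2 [X2a X2b]]] := odd_derivation_beta pcharFp p_gt2 aF bF.
  (* Here $(a,b)=(0,-2)$; the functionals are the coordinates that $\alpha$ and $\beta$ cannot
     reach. *)
  pose psi (i : 'I_2) (f : 'Hom(P2 F, Kac F a b)) : F :=
    if i == 0 then (f (P2_elt 0 0 1 0 0 0 0 0)).2 0 ord_max
    else (f (P2_elt 0 0 0 1 0 0 0 0)).2 0 ord0.
  apply: (dimE 2%N true (fun i => if i == 0 then X1 else X2) psi).
  - move=> i k f h; rewrite /psi !add_lfunE !scale_lfunE.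
    by case: ifP => _; rewrite !mxE.
  - by move=> i; case: ifP.
  - have nz : (p - 2 == 0)%N = false by apply/eqP; lia.
    elim/ord2P; elim/ord2P; rewrite /psi /= ?X1a ?X1b ?X2a ?X2b ?vE ?mxE //=.
    by rewrite -[X in (X == _)%:R]/(Phi (b - a)) ba eqxx.
  - by move=> f i inf; rewrite /psi; case: ifP; rewrite ?inner_alpha_max ?inner_beta0.
  - move=> f df; apply: even_in => //; have [/eqP + _] := even_mx _ _ _ df.
    rewrite bF mulf_eq0 => /orP[/eqP //|].
    by rewrite (_ : _ + 1 = -1) ?oppr_eq0 ?oner_eq0 //; ring.
  - move=> f df psi0; apply: (odd_dim_pred pcharFp p_gt2 df e1 aF bF ba).
      exact: (psi0 0).
    exact: (psi0 1).
(* With $a=-b-2$ the Casimir scalar is $4(b+1)(b+2)$, and [nP1] excludes $b=-2$. *)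
have odd_in f : derivation (@P2_par F) (@kac_par F p a b) (@P2_br F)
    (@kac_act F p a b) true f -> (Phi a)%:R + (Phi b)%:R + 2%:R = 0 :> F ->
    (Phi b)%:R + 1 != 0 :> F -> inner (@P2_par F) (@kac_par F p a b)
    (@kac_act F p a b) f.
  move=> df e1 b1; apply: (odd_casimir pcharFp p_gt2 df e1).
  have -> : (Phi a)%:R = - (Phi b)%:R - 2%:R :> F.
    by rewrite -opprD; apply: eqFN; rewrite addrA.
  have -> : ((Phi b)%:R - (- (Phi b)%:R - 2%:R)) *
      ((Phi b)%:R - (- (Phi b)%:R - 2%:R) + 2%:R) =
      2%:R * 2%:R * ((Phi b)%:R + 1) * ((Phi b)%:R + 2%:R) :> F by ring.
  by rewrite e1 eqxx /= in nP1; rewrite !mulf_neq0.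
case: ifPn => [/andP[/orP e1 /eqP e2]|nP2]; last first.
  apply: (dimE 0%N true (fun _ => 0) (fun _ _ => 0)); try by case.
  - move=> f df; apply: even_in => //; have [/eqP c1 /eqP c3] := even_mx _ _ _ df.
    move: c1 c3; rewrite !mulf_eq0 => /orP[/eqP //|b1] /orP[/eqP //|a3].
    case/negP: nP2; rewrite b1 andbT; apply/orP; right.
    have -> : (Phi a)%:R + (Phi b)%:R + 4%:R
      = ((Phi a)%:R + 3%:R) + ((Phi b)%:R + 1) :> F by ring.
    by rewrite (eqP b1) (eqP a3) addr0.
  - move=> f df _; have [e1|] := eqVneq ((Phi a)%:R + (Phi b)%:R + 2%:R : F) 0.
      by apply: odd_in => //; apply: contraNN nP2 => ->; rewrite e1 eqxx.
    move=> e1; apply: (odd_z_neq pcharFp p_gt2 df e1).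
have bF : (Phi b)%:R = - 1 :> F by apply: eqFN.
case: e1 => /eqP e1.
  have aF : (Phi a)%:R = - 1 :> F.
    have -> : (Phi a)%:R = ((Phi a)%:R + (Phi b)%:R + 2%:R)
       - (Phi b)%:R - 2%:R :> F by ring.
    by rewrite e1 bF; ring.
  have ba : Phi (b - a) = 0%N by apply: PhiBE; rewrite ?aF ?bF ?subrr //; lia.
  have [X [dX Xz]] := odd_derivation_ctr pcharFp p_gt2 aF bF ba.
  (* Here $a=b=-1$; the functional is halved because [ctr] takes the value $2$ at $h_1+h_2$. *)
  apply: (dimE 1%N true (fun _ => X)
    (fun _ f => (f (P2_elt 1 1 0 0 0 0 0 0)).2 0 ord_max / 2%:R)) => //.
  - by move=> i k f h; rewrite add_lfunE scale_lfunE !mxE mulrDl mulrA.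
  - move=> i j; rewrite !ord1 eqxx Xz mxE vE -[X in (X == _)%:R]/(Phi (b - a)).
    by rewrite ba eqxx mulr1 divff.
  - by move=> f i inf; rewrite inner_z // mxE mul0r.
  - move=> f df; apply: even_in => //; have [_ /eqP] := even_mx _ _ _ df.
    rewrite aF mulf_eq0 => /orP[/eqP //|].
    by rewrite (_ : _ + 3%:R = 2%:R) ?(negPf two0) //; ring.
  - move=> f df /(_ ord0)/eqP; rewrite mulf_eq0 invr_eq0 (negPf two0) orbF.
    by move/eqP; apply: odd_dim1.
(* The remaining pair $(-3,-1)$ is the only one with an even class; odd derivations are inner since
   $a+b+2=-2\neq 0$. *)
have aF : (Phi a)%:R = - 3%:R :> F.
  have -> : (Phi a)%:R = ((Phi a)%:R + (Phi b)%:R + 4%:R)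
     - (Phi b)%:R - 4%:R :> F by ring.
  by rewrite e1 bF; ring.
have ba : Phi (b - a) = 2%N by apply: PhiBE; rewrite ?aF ?bF //; ring.
have [X [dX Xe]] := even_derivation_ex pcharFp p_gt2 aF bF ba.
apply: (dimE 1%N false (fun _ => X)
  (fun _ f => (f (P2_elt 0 0 0 0 0 1 0 0)).2 0 ord_max)) => //.
- by move=> i k f h; rewrite add_lfunE scale_lfunE !mxE.
- move=> i j; rewrite !ord1 eqxx Xe vE -[X in (X == _)%:R]/(Phi (b - a)).
  by rewrite ba eqxx.
- by move=> f i inf; rewrite inner_e24 // mxE.
- move=> f df; apply: (odd_z_neq pcharFp p_gt2 df _).
  by rewrite aF bF (_ : _ + 2%:R = - 2%:R) ?oppr_eq0 //; ring.
- by move=> f df /(_ ord0); apply: even_in.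
Qed.
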